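(* Let $A=(A(i,j),\,0\le i,j\le n-1)$ be an irreducible and aperiodic $0$-$1$ matrix, $P=(P(i,j),\,0\le i,j\le n-1)$ a stochastic matrix compatible with $A$, $\bar p$ the probability vector with $\bar pP=\bar p$, and $\bar\mu_P$ the corresponding shift-invariant Markov measure on $\Sigma_A^+$. The following conditions are equivalent. (1) The measure $\bar\mu_P$ is ergodic under the adic transformation $T^*_{\Sigma_A^+}$ (or, equivalently, under the relation $S_A^+$). (2) For every Borel set $B\subset\Sigma_A^+$, $$\lim_{m\to\infty}\frac{\bar\mu_P(B\cap[[\psi_0(m+1,x)]]_m\cap[x_m]_m)}{\bar\mu_P([[\psi_0(m+1,x)]]_m\cap[x_m]_m)}=\lim_{m\to\infty}\frac{\bar\mu_P(B\cap[[\psi_0(m+1,x)]]_m)}{\bar\mu_P([[\psi_0(m+1,x)]]_m)}=\bar\mu_P(B)\quad\text{for }\bar\mu_P\text{-a.e. }x.$$ (3) For every $i\in\{0,\dots,n-1\}$, $$\lim_{m\to\infty}\frac{\bar\mu_P([i]_0\cap[[\psi_0(m+1,x)]]_m\cap[x_m]_m)}{\bar\mu_P([[\psi_0(m+1,x)]]_m\cap[x_m]_m)}=\lim_{m\to\infty}\frac{\bar\mu_P([i]_0\cap[[\psi_0(m+1,x)]]_m)}{\bar\mu_P([[\psi_0(m+1,x)]]_m)}=\bar p(i)\quad\text{for }\bar\mu_P\text{-a.e. }x.$$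
   Context: $\Sigma_A^+=\{x=(x_k)_{k\ge0}\in\{0,\dots,n-1\}^{\mathbb{N}}: A(x_k,x_{k+1})=1\ \forall k\ge0\}$. For a symbol $i$ and $m\ge0$, $[i]_m=\{x\in\Sigma_A^+:x_m=i\}$. ''$P$ compatible with $A$'' means $P(i,j)>0$ if and only if $A(i,j)=1$. The measure $\bar\mu_P$ is given on cylinders by $$\bar\mu_P(\{x:x_m=v_0,\dots,x_{m+l}=v_l\})=\bar p(v_0)P(v_0,v_1)\cdots P(v_{l-1},v_l).$$ $S_A^+$ is the equivalence relation on $\Sigma_A^+$ in which $x\sim x'$ iff there is $K$ with $x_k=x'_k$ for all $k\ge K$ and $(x_0,\dots,x_{K-1})$ is a permutation of $(x'_0,\dots,x'_{K-1})$. On each $S_A^+$-class define a total order by $x\prec x'$ iff $x_m<x'_m$ for $m=\max\{k:x_k\ne x'_k\}$. The adic transformation $T^*_{\Sigma_A^+}$ maps $x$ to its immediate successor in its $S_A^+$-class if that class has neither a maximal nor a minimal element, and is the identity on the (countable) set of points whose class has a maximal or a minimal element; off this countable set its orbits are exactly the $S_A^+$-classes. $\bar\mu_P$ is quasi-invariant under $S_A^+$ (the union of the classes meeting a null set is null). It is ergodic under $S_A^+$ if for every Borel set $B$, either the union of all $S_A^+$-classes meeting $B$ or the complement of this union is $\bar\mu_P$-null. With $e^{(0)},\dots,e^{(n-1)}$ the unit vectors of $\mathbb{Z}^n$, put $\psi_0(m,x)=\sum_{k=0}^{m-1}e^{(x_k)}\in\mathbb{Z}^n$ (the vector of symbol counts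 of $x_0,\dots,x_{m-1}$), and for $s\in\mathbb{Z}^n$ and $m\ge1$ put $[[s]]_m=\{x\in\Sigma_A^+:\psi_0(m+1,x)=s\}$. *)

(* Defs.v *)
From HB Require Import structures.
From mathcomp Require Import all_boot all_order all_algebra.
From mathcomp Require Import all_classical all_reals all_analysis.
Export numFieldNormedType.Exports.

Set Implicit Arguments.
Unset Strict Implicit.
Unset Printing Implicit Defensive.

Import Order.TTheory GRing.Theory Num.Theory.

Local Open Scope classical_set_scope.
Local Open Scope ring_scope.

(* The alphabet {0, ..., n-1} is written 'I_n.+1, i.e. it has n + 1 >= 1 symbols:
   the empty alphabet carries no probability vector. *)

Section Matrices.
Variable n : nat.
Implicit Types A : 'M[nat]_n.+1.

Definition zero_one_mx A := forall i j, A i j = 0%N \/ A i j = 1%N.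

(* Powers are taken over the semiring nat, so that (A ^+ m) i j is the number
   of admissible paths of length m from i to j. *)
Definition irreducible_mx A :=
  forall i j, exists2 m, (0 < m)%N & (0 < (A ^+ m) i j)%N.

(* The gcd of the set of return times of every symbol is 1. *)
Definition aperiodic_mx A :=
  forall i (d : nat),
    (forall m, (0 < m)%N -> (0 < (A ^+ m) i i)%N -> (d %| m)%N) -> d = 1%N.

Definition stochastic_mx (R : realType) (P : 'M[R]_n.+1) :=
  (forall i j, 0 <= P i j) /\ (forall i, \sum_j P i j = 1).

Definition probability_vector (R : realType) (p : 'rV[R]_n.+1) :=
  (forall i, 0 <= p 0 i) /\ \sum_i p 0 i = 1.

Definition compatible_mx (R : realType) (P : 'M[R]_n.+1) A :=
  forall i j, (0 < P i j) <-> (A i j = 1%N).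

(* Sequences carry the product topology of the discrete topologies. *)
Definition admissible A : set {ptws nat -> discrete_topology 'I_n.+1} :=
  [set x | forall k, A (x k) (x k.+1) = 1%N].

Lemma admissible_nonempty A :
  zero_one_mx A -> irreducible_mx A -> exists x, admissible A x.
Proof.
move=> A01 Airr.
have next i : exists j, A i j == 1%N.
  have [[//|m] _ Am] := Airr i i.
  apply/existsP; apply: contraLR Am; rewrite negb_exists => /forallP Ai0.
  rewrite -leqNgt leqn0 exprS mxE big1 // => j _.
  by have /negPf := Ai0 j; have [->|->] := A01 i j; rewrite ?mul0r ?eqxx.
pose f i := xchoose (next i).
by exists (fun k => iter k f ord0) => k; exact/eqP/(xchooseP (next _)).
Qed.

End Matrices.

(* Sigma_A^+, with the topology induced from the product topology and its
   Borel sigma-algebra. The hypotheses on A only serve to provide the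
   base point that the library requires of a measurable type. *)
Definition shift_space n (A : 'M[nat]_n.+1)
    (A01 : zero_one_mx A) (Airr : irreducible_mx A) : Type :=
  set_type (admissible A).

Section ShiftSpaceInstances.
Context n (A : 'M[nat]_n.+1) (A01 : zero_one_mx A) (Airr : irreducible_mx A).

HB.instance Definition _ :=
  Topological.copy (shift_space A01 Airr) (set_type (admissible A)).

Let base_point : shift_space A01 Airr :=
  let: exist x Ax := cid (admissible_nonempty A01 Airr) in exist _ x (mem_set Ax).

HB.instance Definition _ := isPointed.Build (shift_space A01 Airr) base_point.

HB.instance Definition _ := Measurable.copy (shift_space A01 Airr)
  (g_sigma_algebraType (@open (shift_space A01 Airr))).

Definition sequence_of (x : shift_space A01 Airr) : nat -> 'I_n.+1 := set_val x.

End ShiftSpaceInstances.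

Coercion sequence_of : shift_space >-> Funclass.

Section SequenceRelations.
Variable n : nat.
Implicit Types x y : nat -> 'I_n.+1.

Definition psi0 (m : nat) x : 'rV[int]_n.+1 := \sum_(k < m) delta_mx 0 (x k).

(* The relation S_A^+, and the order on its classes: the m below is the
   largest coordinate at which x and y differ. *)
Definition S_rel x y := exists K : nat,
  (forall k, (K <= k)%N -> x k = y k) /\ perm_eq (mkseq x K) (mkseq y K).

Definition prec x y := exists m : nat,
  (x m < y m)%N /\ (forall k, (m < k)%N -> x k = y k).

End SequenceRelations.

Section Adic.
Context n (A : 'M[nat]_n.+1) (A01 : zero_one_mx A) (Airr : irreducible_mx A).
Local Notation X := (shift_space A01 Airr).
Implicit Types x y z : X.

Definition symbol_set (i : 'I_n.+1) (m : nat) : set X := [set x | x m = i].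

Definition count_set (s : 'rV[int]_n.+1) (m : nat) : set X :=
  [set x | psi0 m.+1 x = s].

Definition class_has_max x :=
  exists y, S_rel x y /\ (forall z, S_rel x z -> ~ prec y z).

Definition class_has_min x :=
  exists y, S_rel x y /\ (forall z, S_rel x z -> ~ prec z y).

Definition immediate_successor x y :=
  [/\ S_rel x y, prec x y & forall z, S_rel x z -> ~ (prec x z /\ prec z y)].

(* In a class with neither a maximal nor a minimal element every point has
   exactly one immediate successor, which is what xget returns. *)
Definition adic x : X :=
  if `[< class_has_max x \/ class_has_min x >] then x
  else xget x [set y | immediate_successor x y].

Definition S_saturation (B : set X) : set X :=
  [set x | exists2 y, B y & S_rel x y].

Variable R : realType.

(* v is a word v_0 ... v_l; its values beyond l are irrelevant. *)
Definition is_markov_measure (P : 'M[R]_n.+1) (p : 'rV[R]_n.+1)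
    (mu : set X -> \bar R) :=
  forall (m l : nat) (v : nat -> 'I_n.+1),
    mu [set x : X | forall k, (k <= l)%N -> x (m + k)%N = v k] =
      (p 0 (v 0%N) * \prod_(k < l) P (v k) (v k.+1))%:E.

Definition ergodic_S (mu : set X -> \bar R) :=
  forall B : set X, measurable B ->
    mu.-negligible (S_saturation B) \/ mu.-negligible (~` S_saturation B).

End Adic.

Definition ergodic_map d (T : measurableType d) (R : realType)
    (mu : set T -> \bar R) (f : T -> T) :=
  forall B : set T, measurable B -> f @^-1` B = B ->
    mu B = 0%E \/ mu (~` B) = 0%E.

(* A real quotient: x / 0 = 0, but E has positive measure wherever this is used. *)
Definition cond_prob d (T : measurableType d) (R : realType)
    (mu : set T -> \bar R) (B E : set T) : R :=
  fine (mu (B `&` E)) / fine (mu E).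

(* Main.v *)
(** Two points are equivalent when they share a tail and the symbol counts of the
    prefixes before it, so by the Markov property the conditional probability of
    an event B of the past, given the counts and the last symbol at time m, is
    not affected by any further event of the future. If B is a cylinder and the
    conditional probability exceeds lam infinitely often, which is an invariant
    condition and hence almost sure under ergodicity, then decomposing according
    to the last such time gives lam <= mu B. Applied to B and its complement this
    yields the limit, and Doob's maximal inequality for the prefixes extends it
    to all Borel sets. To drop the conditioning on the last symbol one uses that,
    under ergodicity, the counts of loops generate Z^n: from any two symbols i
    and j there are words with equal counts and a common end, so a count vector
    at which the last symbol j is both likely and bad cannot be met infinitely
    often with last symbol i.

    Conversely the limits for symbols say that an invariant event B is
    independent of the first symbol. Removing the first symbol i from B gives
    another invariant event, so by induction B is independent of all cylinders,
    hence of itself. Finally, exchangeable words recur almost surely, so almost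
    every class has no maximum and no minimum, and on such classes the orbits of
    the adic transformation are the classes, since intervals are finite. *)
Require Import Defs.
From mathcomp Require Import all_boot all_order all_algebra.
From mathcomp Require Import all_classical all_reals all_analysis.
From mathcomp Require Import zify ring lra.

Set Implicit Arguments.
Unset Strict Implicit.
Unset Printing Implicit Defensive.

Import Order.TTheory GRing.Theory Num.Theory.

Local Open Scope classical_set_scope.
Local Open Scope ring_scope.

(** * Real-valued probabilities, events occurring infinitely often, covering inequalities *)

Section RealProbability.
Context d (T : measurableType d) (R : realType) (mu : probability T R).
Implicit Types B C : set T.

Definition pr B : R := fine (mu B).

Lemma prE B : measurable B -> mu B = (pr B)%:E.
Proof. by move=> mB; rewrite fineK// fin_num_measure. Qed.

Lemma pr_ge0 B : 0 <= pr B.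
Proof. exact: fine_ge0. Qed.

Lemma pr_set0 : pr set0 = 0.
Proof. by rewrite /pr measure0. Qed.

Lemma pr_setT : pr setT = 1.
Proof. by rewrite /pr probability_setT. Qed.

Lemma pr_le B C : measurable B -> measurable C -> B `<=` C -> pr B <= pr C.
Proof. by move=> mB mC BC; rewrite -lee_fin -!prE// le_measure ?inE. Qed.

Lemma pr_le1 B : measurable B -> pr B <= 1.
Proof. by move=> mB; rewrite -pr_setT pr_le. Qed.

Lemma prU B C : measurable B -> measurable C -> B `&` C = set0 ->
  pr (B `|` C) = pr B + pr C.
Proof.
move=> mB mC BC; apply: EFin_inj.
by rewrite EFinD -!prE//; [rewrite measureU|exact: measurableU].
Qed.

Lemma prIC B C : measurable B -> measurable C ->
  pr B = pr (B `&` C) + pr (B `&` ~` C).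
Proof.
move=> mB mC; rewrite -prU.
- by rewrite -setIUr setUCr setIT.
- exact: measurableI.
- by apply: measurableI => //; exact: measurableC.
- by rewrite setIACA setICr setI0.
Qed.

Lemma prC B : measurable B -> pr (~` B) = 1 - pr B.
Proof. by move=> mB; have := prIC measurableT mB; rewrite !setTI pr_setT => ->; ring. Qed.

Lemma prU_le B C : measurable B -> measurable C -> pr (B `|` C) <= pr B + pr C.
Proof.
move=> mB mC; have mBC := measurableU _ _ mB mC.
rewrite (prIC mBC mB); apply: lerD; apply: pr_le => //.
- exact: measurableI.

- by apply: measurableI => //; exact: measurableC.
- by move=> x [[|]].
Qed.

Lemma pr_fibers (I : finType) (f : T -> I) B :
  (forall i, measurable [set x | f x = i]) -> measurable B ->
  pr B = \sum_i pr (B `&` [set x | f x = i]).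
Proof.
move=> mf mB.
suff H (r : seq I) : uniq r -> measurable [set x | f x \in r] /\
    pr (B `&` [set x | f x \in r]) = \sum_(i <- r) pr (B `&` [set x | f x = i]).
  have [_] := H _ (index_enum_uniq I).
  suff -> : [set x | f x \in index_enum I] = setT by rewrite setIT.
  by apply/seteqP; split => x //= _; rewrite mem_index_enum.
elim: r => [|i r IH] /=.
  move=> _; rewrite big_nil.
  have -> : [set x | f x \in [::]] = set0 by apply/seteqP; split.
  by rewrite setI0 pr_set0.
move=> /andP[ir /IH [mr Hr]].
have -> : [set x | f x \in i :: r] = [set x | f x = i] `|` [set x | f x \in r].
  apply/seteqP; split => x /=; rewrite inE.
    by move=> /orP[/eqP|]; [left|right].
  by move=> [->|->]; rewrite ?eqxx ?orbT.
split; first exact: measurableU.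
rewrite big_cons setIUr prU ?Hr//; try exact: measurableI.
rewrite setIACA setIid; apply/seteqP; split => x //= [_ [fx]].
by rewrite fx (negPf ir).
Qed.

Lemma pr_bigcup_le (F : (set T)^nat) (c : R) : (forall k, measurable (F k)) ->
  (forall M, pr (\bigcup_(k in `I_M) F k) <= c) -> pr (\bigcup_k F k) <= c.
Proof.
move=> mF Fc.
have mU M : measurable (\bigcup_(k in `I_M) F k).
  by apply: bigcup_measurable.
have UE : \bigcup_M (\bigcup_(k in `I_M) F k) = \bigcup_k F k.
  apply/seteqP; split => x; first by move=> [M _ [k _ Fk]]; exists k.
  by move=> [k _ Fk]; exists k.+1 => //; exists k => //=.
have ndU : {homo (fun M => \bigcup_(k in `I_M) F k) : n m / (n <= m)%N >-> (n <= m)%O}.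
  move=> a b ab; apply/subsetPset => x [k /= ka Fk]; exists k => //=.
  exact: leq_trans ka ab.
have cv := @nondecreasing_cvg_mu _ _ _ mu _ mU (bigcupT_measurable _ mU) ndU.
rewrite UE in cv.
rewrite -lee_fin -prE; last by apply: bigcup_measurable.
rewrite -(cvg_lim _ cv)//; apply: lime_le; first by apply/cvg_ex; eexists; exact: cv.
by near=> M; rewrite /= prE// lee_fin.
Unshelve. all: by end_near. Qed.

Lemma pr_bigcup_cvg (F : (set T)^nat) : (forall k, measurable (F k)) ->
  trivIset setT F ->
  (fun N => \sum_(0 <= k < N) pr (F k)) @ \oo --> pr (\bigcup_k F k).
Proof.
move=> mF tF.
have : (fun N => (\sum_(0 <= k < N) mu (F k))%E) @ \oo --> (pr (\bigcup_k F k))%:E.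
  rewrite -prE; last exact: bigcupT_measurable.
  by apply: measure_semi_sigma_additive => //; exact: bigcupT_measurable.
move=> /fine_cvgP[_]; apply: cvg_trans; apply: near_eq_cvg; near=> N.
rewrite /= -[RHS]/(fine (_%:E)) -sumEFin; congr fine.
by apply: eq_bigr => k _; rewrite prE.
Unshelve. all: by end_near. Qed.

Lemma pr_nonincreasing_le (F : (set T)^nat) (c : R) : (forall k, measurable (F k)) ->
  (forall k l, (k <= l)%N -> F l `<=` F k) ->
  (forall k, c <= pr (F k)) -> c <= pr (\bigcap_k F k).
Proof.
move=> mF dF Fc.
have mI : measurable (\bigcap_k F k) by apply: bigcapT_measurable.
have : pr (\bigcup_k ~` F k) <= 1 - c.
  apply: pr_bigcup_le => [k|M]; first exact: measurableC.
  apply: (@le_trans _ _ (pr (~` F M))); last by rewrite prC// lerD2l lerN2.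
  apply: pr_le; last by move=> x [k /= kM Fk]; apply: contra_not Fk => FM;
    apply: dF FM; exact: ltnW.
  - by apply: bigcup_measurable => k _; exact: measurableC.
  - exact: measurableC.
by rewrite -setC_bigcap prC//; lra.
Qed.

Definition infinitely_often (Q : nat -> set T) : set T :=
  [set x | forall N, exists2 m, (N <= m)%N & Q m x].

Lemma infinitely_oftenE Q :
  infinitely_often Q = \bigcap_N \bigcup_(m in [set m | (N <= m)%N]) Q m.
Proof.
by apply/seteqP; split => x H N; [have [m] := H N; exists m|have [m] := H N I; exists m].
Qed.

Lemma infinitely_often_measurable Q : (forall m, measurable (Q m)) ->
  measurable (infinitely_often Q).
Proof.
move=> mQ; rewrite infinitely_oftenE; apply: bigcapT_measurable => N.
exact: bigcup_measurable.
Qed.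

Lemma infinitely_often_le Q N : (forall m, measurable (Q m)) ->
  pr (infinitely_often Q) <= pr (\bigcup_(m in [set m | (N <= m)%N]) Q m).
Proof.
move=> mQ; apply: pr_le; first exact: infinitely_often_measurable.
  exact: bigcup_measurable.
by move=> x /(_ N)[m]; exists m.
Qed.

Lemma pr_infinitely_often_ge Q c : (forall m, measurable (Q m)) ->
  (forall N, c <= pr (\bigcup_(m in [set m | (N <= m)%N]) Q m)) ->
  c <= pr (infinitely_often Q).
Proof.
move=> mQ Qc; rewrite infinitely_oftenE; apply: pr_nonincreasing_le => //.
  by move=> k; exact: bigcup_measurable.
by move=> k l kl x [m /= lm Qm]; exists m => //=; exact: leq_trans lm.
Qed.

(** Continuity from above along the tail unions. This is the quantitative form in which the nullity
    of an upper limit of events is used later. *)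
Lemma tail_union_small Q e : (forall m, measurable (Q m)) ->
  pr (infinitely_often Q) = 0 -> 0 < e ->
  exists N, pr (\bigcup_(m in [set m | (N <= m)%N]) Q m) < e.
Proof.
move=> mQ Q0 e0; apply/not_existsP => H.
have : e <= pr (infinitely_often Q).
  by apply: pr_infinitely_often_ge => // N; rewrite leNgt; apply/negP; exact: H.
by rewrite Q0 leNgt e0.
Qed.

(** The countably many thresholds 1 / (k + 1) suffice, so the quantifier over [e] can be exchanged
    with the one over almost every point. This turns every limit of the theorem into the nullity of
    an upper limit of events. *)
Lemma infinitely_often_ae_cvg (c : nat -> T -> R) (l : R) :
  (forall e m, measurable [set x | e < `|c m x - l|]) ->
  (forall e, 0 < e -> pr (infinitely_often (fun m => [set x | e < `|c m x - l|])) = 0) <->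
  {ae mu, forall x, c ^~ x @ \oo --> l}.
Proof.
move=> mc; split=> [H|H e e0].
  pose Z k := infinitely_often (fun m => [set x | k.+1%:R^-1 < `|c m x - l|]).
  have mZ k : measurable (Z k) by exact: infinitely_often_measurable.
  apply: (@negligibleS _ _ _ _ (\bigcup_k Z k)); last first.
    apply: negligible_bigcup => k; apply/negligibleP => //.
    by apply: etrans (prE (mZ k)) _; rewrite H// invr_gt0.
  move=> x /= nx; apply: contrapT => nZ; apply: nx.
  apply/cvgrPdist_le => e e0.
  have /existsNP[N HN] : ~ Z (Num.truncn e^-1) x.
    by move=> Zx; apply: nZ; exists (Num.truncn e^-1).
  exists N => // m /= Nm; rewrite distrC leNgt; apply/negP => em; apply: HN.
  exists m => //=; apply: le_lt_trans em.
  rewrite invf_ple ?posrE// ltW//; exact: truncnS_gt.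
set Z := infinitely_often _.
suff H0 : mu Z = 0%E by rewrite /pr H0.
apply: measure_negligible; first exact: infinitely_often_measurable.
apply: negligibleS H => x Zx cx.
have [N _ HN] := (cvgrPdist_le _ _).1 cx _ e0.
have [m Nm] := Zx N; move/(HN m): Nm; rewrite /= distrC => ce.
by rewrite ltNge ce.
Qed.

(* V is the event that m is the last index below M, in the next lemma the first
   index, at which Q occurs: these pieces are disjoint. *)
Lemma last_index_cover (Q : (set T)^nat) U lam : 0 <= lam -> measurable U ->
  (forall m, measurable (Q m)) ->
  (forall m M V, V = Q m `\` \bigcup_(k in [set k | (m < k < M)%N]) Q k ->
     lam * pr V <= pr (U `&` V)) ->
  lam * pr (\bigcup_k Q k) <= pr U.
Proof.
move=> lam0 mU mQ H.
suff K M : lam * pr (\bigcup_(k in `I_M) Q k) <= pr U.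
  move: lam0; rewrite le_eqVlt => /orP[/eqP<-|lam0]; first by rewrite mul0r pr_ge0.
  rewrite mulrC -ler_pdivlMr//; apply: pr_bigcup_le => [//|M].
  by rewrite ler_pdivlMr// mulrC.
pose W m := \bigcup_(k in [set k | (m <= k < M)%N]) Q k.
have mW m : measurable (W m) by apply: bigcup_measurable.
(* The indices are added from [M - 1] downwards: the new index [m] contributes the points at which
   it is the last occurrence below [M], disjoint from those already covered. *)
suff K' j : lam * pr (W (M - j)%N) <= pr (U `&` W (M - j)%N).
  have := K' M; rewrite subnn => /le_trans; apply.
  by apply: pr_le => //; exact: measurableI.
elim: j => [|j IH].
  suff -> : W (M - 0)%N = set0 by rewrite pr_set0 mulr0 pr_ge0.
  by apply/seteqP; split => x // -[k /=]; lia.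
have [Mj|jM] := leqP M j; first by rewrite (_ : M - j.+1 = M - j)%N//; lia.
set m := (M - j.+1)%N; have mE : (M - j = m.+1)%N by rewrite /m; lia.
rewrite mE in IH; pose V := Q m `\` W m.+1.
have WE : W m = V `|` W m.+1.
  apply/seteqP; split => x.
    move=> [k /= km Qk]; have [Wx|Wx] := pselect (W m.+1 x); first by right.
    left; split => //; suff <- : k = m by [].
    apply/eqP; apply/negPn/negP => km'; apply: Wx; exists k => //=.
    by lia.
  move=> [[Qx _]|[k /= km Qk]]; first by exists m => //=; rewrite /m; lia.
  by exists k => //=; lia.
have mV : measurable V by apply: measurableD.
have VW : V `&` W m.+1 = set0 by rewrite /V setDE -setIA setICl setI0.
rewrite WE prU// mulrDr setIUr prU; try exact: measurableI.
  by apply: lerD => //; exact: (H m M).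
by rewrite setIACA VW setI0.
Qed.

Lemma first_index_cover (Q : (set T)^nat) U lam : 0 <= lam -> measurable U ->
  (forall m, measurable (Q m)) ->
  (forall m V, V = Q m `\` \bigcup_(k in `I_m) Q k ->
     lam * pr V <= pr (U `&` V)) ->
  lam * pr (\bigcup_k Q k) <= pr U.
Proof.
move=> lam0 mU mQ H.
suff K M : lam * pr (\bigcup_(k in `I_M) Q k) <= pr U.
  move: lam0; rewrite le_eqVlt => /orP[/eqP<-|lam0]; first by rewrite mul0r pr_ge0.
  rewrite mulrC -ler_pdivlMr//; apply: pr_bigcup_le => [//|M].
  by rewrite ler_pdivlMr// mulrC.
pose W m := \bigcup_(k in `I_m) Q k.
have mW m : measurable (W m) by apply: bigcup_measurable.
suff K' m : lam * pr (W m) <= pr (U `&` W m).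
  apply: le_trans (K' M) _.
  by apply: pr_le => //; exact: measurableI.
elim: m => [|m IH].
  suff -> : W 0%N = set0 by rewrite pr_set0 mulr0 pr_ge0.
  by apply/seteqP; split => x // -[].
pose V := Q m `\` W m.
have WE : W m.+1 = V `|` W m.
  apply/seteqP; split => x.
    move=> [k /= km Qk]; have [Wx|Wx] := pselect (W m x); first by right.
    left; split => //; suff <- : k = m by [].
    apply/eqP; apply/negPn/negP => km'; apply: Wx; exists k => //=.
    by lia.
  move=> [[Qx _]|[k /= km Qk]]; first by exists m => //=.
  by exists k => //=; lia.
have mV : measurable V by apply: measurableD.
have VW : V `&` W m = set0 by rewrite /V setDE -setIA setICl setI0.
rewrite WE prU// mulrDr setIUr prU; try exact: measurableI.
  by apply: lerD => //; exact: (H m).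
by rewrite setIACA VW setI0.
Qed.

End RealProbability.

(** * Cylinders and events determined by finitely many coordinates *)

Section ShiftSpace.
Context n (A : 'M[nat]_n.+1) (A01 : zero_one_mx A) (Airr : irreducible_mx A).
Local Notation X := (shift_space A01 Airr).
Implicit Types (x y z : X) (Q B : set X) (v : nat -> 'I_n.+1).

Lemma shift_space_admissible x k : A (x k) (x k.+1) = 1%N.
Proof. by case: x => s As; rewrite /sequence_of /=; exact: (set_mem As). Qed.

Lemma shift_space_ext x y : x =1 y -> x = y.
Proof.
move=> xy; apply: val_inj; apply/funext => k; exact: xy.
Qed.

Lemma shift_space_exists v : (forall k, A (v k) (v k.+1) = 1%N) ->
  exists x, x =1 v.
Proof. by move=> Av; exists (exist _ v (mem_set Av) : X). Qed.

Definition cyl m v : set X := [set x | forall k, (k <= m)%N -> x k = v k].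

(** Membership in the finite algebra generated by the coordinates 0, ..., m, put pointwise so that
    no union of cylinders has to be exhibited. *)
Definition det m Q := forall x y, (forall k, (k <= m)%N -> x k = y k) -> Q x -> Q y.

Lemma coord_continuous k : continuous (fun x : X => x k : discrete_topology 'I_n.+1).
Proof.
move=> x; apply: (@continuous_comp _ _ _
  (set_val : X -> {ptws nat -> discrete_topology 'I_n.+1}) (fun f => f k)).
  exact: initial_continuous.
exact: (@proj_continuous nat (fun=> discrete_topology 'I_n.+1) k).
Qed.

Lemma coord_open k i : open [set x : X | x k = i].
Proof.
rewrite (_ : [set _ | _] = (fun x : X => x k : discrete_topology 'I_n.+1) @^-1` [set i])//.
have /continuousP := @coord_continuous k; apply.
exact: discrete_open.
Qed.

(** Otherwise every [cyl m x] contains a point outside [O], and these points converge coordinatewise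
    to [x]. *)
Lemma open_cyl_sub (O : set X) x : open O -> O x -> exists m, cyl m x `<=` O.
Proof.
move=> [V oV <-] Ox; apply/not_existsP => H.
have /choice[y Hy] m : exists y, cyl m x y /\ ~ V (set_val y).
  by have /existsNP[y /not_implyP] := H m; exists y.
have cv : (fun m => set_val (y m)) @ \oo -->
    (set_val x : {ptws nat -> discrete_topology 'I_n.+1}).
  apply/(@pointwise_cvgP nat (discrete_topology 'I_n.+1)) => k.
  apply: cvg_near_cst; exists k => // m /= km.
  exact: (Hy m).1.
have : \forall m \near \oo, V (set_val (y m)) by apply: cv; exact: open_nbhs_nbhs.
by case=> N _ /(_ N (leqnn _)); apply: (Hy N).2.
Qed.

Lemma cyl_open m v : open (cyl m v).
Proof.
elim: m => [|m IH].
  rewrite (_ : cyl 0 v = [set x | x 0%N = v 0%N]); first exact: coord_open.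
  by apply/seteqP; split => x /= H; [exact: H|move=> k; rewrite leqn0 => /eqP->].
rewrite (_ : cyl m.+1 v = cyl m v `&` [set x | x m.+1 = v m.+1]).
  by apply: openI => //; exact: coord_open.
apply/seteqP; split => x /=.
  by move=> H; split => [k km|]; apply: H => //; exact: leqW.
by move=> [H1 H2] k; rewrite leq_eqVlt => /orP[/eqP->//|]; exact: H1.
Qed.

Lemma open_measurable_shift (O : set X) : open O -> measurable O.
Proof. by move=> oO; exact: sub_sigma_algebra. Qed.

Lemma cyl_measurable m v : measurable (cyl m v).
Proof. by apply: open_measurable_shift; exact: cyl_open. Qed.

Definition word m (x : nat -> 'I_n.+1) : {ffun 'I_m.+1 -> 'I_n.+1} := [ffun k : 'I_m.+1 => x k].

(** Turns a finite word into a sequence, as [cyl] expects; the values beyond [m] are junk that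
    [cyl m] never reads. *)
Definition word_seq m (w : {ffun 'I_m.+1 -> 'I_n.+1}) k := w (inord k).

Lemma word_seqK m (x : nat -> 'I_n.+1) k : (k <= m)%N -> word_seq (word m x) k = x k.
Proof. by move=> km; rewrite /word_seq ffunE inordK. Qed.

Lemma word_fiber m w : [set x : X | word m x = w] = cyl m (word_seq w).
Proof.
apply/seteqP; split => x /=; first by move=> <- k km; rewrite word_seqK.
by move=> H; apply/ffunP => k; rewrite ffunE H -1?ltnS// /word_seq inord_val.
Qed.

Lemma det_bigcup m Q : det m Q ->
  Q = \bigcup_(w in [set w | cyl m (@word_seq m w) `<=` Q]) cyl m (word_seq w).
Proof.
move=> dQ; apply/seteqP; split => x; last by move=> [w]; exact.
move=> Qx; exists (word m x) => [y /= Hy|k km]; last by rewrite word_seqK.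
by apply: dQ Qx => k km; rewrite Hy// word_seqK.
Qed.

Lemma det_measurable m Q : det m Q -> measurable Q.
Proof.
move=> /det_bigcup ->; apply: fin_bigcup_measurable => [|w _].
  exact: finite_finset.
exact: cyl_measurable.
Qed.

Lemma det_cyl m v : det m (cyl m v).
Proof. by move=> x y xy Hx k km; rewrite -xy// Hx. Qed.

Lemma detW m m' Q : (m <= m')%N -> det m Q -> det m' Q.
Proof. by move=> mm dQ x y xy; apply: dQ => k km; apply: xy; exact: leq_trans mm. Qed.

Lemma detC m Q : det m Q -> det m (~` Q).
Proof. by move=> dQ x y xy; apply: contra_not; apply: dQ => k km; rewrite xy. Qed.

Lemma detI m Q B : det m Q -> det m B -> det m (Q `&` B).
Proof. by move=> dQ dB x y xy [Qx Bx]; split; [exact: dQ Qx|exact: dB Bx]. Qed.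

Lemma det_bigcupP m (P : set nat) (F : nat -> set X) :
  (forall k, P k -> det m (F k)) -> det m (\bigcup_(k in P) F k).
Proof. by move=> dF x y xy [k Pk Fk]; exists k => //; exact: dF Fk. Qed.

(** Dynkin's theorem. The cylinders together with the empty set are closed under intersection, and
    they generate the Borel sets because an open set [O] is the union over [m] of the points with
    [cyl m x] inside [O], each a finite union of cylinders. *)
Lemma borel_ind (Pr : set X -> Prop) :
  Pr set0 -> (forall m v, Pr (cyl m v)) ->
  (forall B, measurable B -> Pr B -> Pr (~` B)) ->
  (forall F : (set X)^nat, (forall k, measurable (F k)) -> trivIset setT F ->
     (forall k, Pr (F k)) -> Pr (\bigcup_k F k)) ->
  forall B, measurable B -> Pr B.
Proof.
move=> Pr0 Prcyl PrC PrU.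
pose G := [set B : set X | B = set0 \/ exists m v, B = cyl m v].
have mG : @measurable _ X = <<s G >>.
  apply/seteqP; split.
    apply: smallest_sub; first exact: smallest_sigma_algebra.
    move=> O oO.
    have -> : O = \bigcup_m [set x : X | cyl m x `<=` O].
      apply/seteqP; split => x; first by move=> /(open_cyl_sub oO)[m]; exists m.
      by move=> [m _]; apply.
    have H m : <<s G >> [set x : X | cyl m x `<=` O].
      have dm : det m [set x : X | cyl m x `<=` O].
        by move=> x y xy /= H z Hz; apply: H => k km; rewrite Hz// xy.
      rewrite (det_bigcup dm).
      apply: (@fin_bigcup_measurable _ (g_sigma_algebraType G)) => [|w _].
        exact: finite_finset.
      by apply: sub_sigma_algebra; right; exists m, (word_seq w).
    exact: (@bigcupT_measurable _ (g_sigma_algebraType G)).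
  apply: smallest_sub; first exact: sigma_algebra_measurable.
  move=> B [->|[m [v ->]]]; first exact: measurable0.
  exact: cyl_measurable.
have GI : setI_closed G.
  move=> B C GB GC; have [->|/set0P[z [Bz Cz]]] := eqVneq (B `&` C) set0; first by left.
  case: GB Bz => [->//|[m [v ->]]] Bz; case: GC Cz => [->//|[l [u ->]]] Cz.
  right; exists (maxn m l), z; apply/seteqP; split => x /=.
    move=> [Hm Hl] k; rewrite leq_max => /orP[km|kl]; first by rewrite (Hm _ km) (Bz _ km).
    by rewrite (Hl _ kl) (Cz _ kl).
  move=> H; split => k kk; rewrite H ?leq_max ?kk ?orbT//.
  - exact: Bz.
  - exact: Cz.
move=> B; rewrite mG => GB.
apply: (@dynkin_induction _ X G) => //.
- by rewrite -setC0; apply: PrC.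
- by move=> C [->//|[m [v ->]]].
Qed.

End ShiftSpace.

(** * Symbol counts of prefixes and the tail permutation relation *)

Section SymbolCounts.
Variable n : nat.
Implicit Types x y : nat -> 'I_n.+1.

Lemma psi0E m x i : psi0 m x 0 i = (count_mem i (mkseq x m))%:Z.
Proof.
elim: m => [|m IH]; first by rewrite /psi0 big_ord0 mxE.
have -> : psi0 m.+1 x = psi0 m x + delta_mx 0 (x m) by rewrite /psi0 big_ord_recr.
rewrite mxE IH mxE mkseqS -cats1 count_cat /= addn0 PoszD [i == _]eq_sym.
by case: eqP.
Qed.

Lemma psi0_perm m x y : psi0 m x = psi0 m y <-> perm_eq (mkseq x m) (mkseq y m).
Proof.
split=> [H|H].
  apply/allP => i _ /=; have /rowP/(_ i) := H; rewrite !psi0E => -[->].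
  exact: eqxx.
by apply/rowP => i; rewrite !psi0E; move/permP: H => ->.
Qed.

(* The counts are at most m.+1, so inord does not truncate them. *)
Definition key m x : {ffun 'I_n.+1 -> 'I_m.+2} * 'I_n.+1 :=
  ([ffun i => inord (count_mem i (mkseq x m.+1))], x m).

Lemma keyP m x y :
  key m x = key m y <-> perm_eq (mkseq x m.+1) (mkseq y m.+1) /\ x m = y m.
Proof.
split=> [[/ffunP H ->]|[H xy]].
  split => //; apply/allP => i _ /=; have := H i; rewrite !ffunE => /(congr1 (@nat_of_ord _)).
  have B z : (count_mem i (mkseq z m.+1) < m.+2)%N.
    by rewrite ltnS -[leqRHS](size_mkseq z) count_size.
  by rewrite (inordK (B x)) (inordK (B y)) => /eqP.
by rewrite /key xy; congr pair; apply/ffunP => i; rewrite !ffunE; move/permP: H => ->.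
Qed.

Lemma key_psi0 m x y : key m x = key m y <-> psi0 m.+1 x = psi0 m.+1 y /\ x m = y m.
Proof. by rewrite keyP psi0_perm. Qed.

Lemma key_eq m x y : (forall k, (k <= m)%N -> x k = y k) -> key m x = key m y.
Proof.
move=> xy; apply/keyP; split; last exact: xy.
suff -> : mkseq x m.+1 = mkseq y m.+1 by [].
by apply/eq_in_map => k; rewrite mem_iota => /andP[_ km]; apply: xy.
Qed.

Lemma key_trans m m' x y : (m <= m')%N -> key m x = key m y ->
  (forall k, (m <= k)%N -> x k = y k) -> key m' x = key m' y.
Proof.
move=> mm /keyP[pxy xy] tl; apply/keyP; split; last exact: tl.
rewrite -(subnKC mm) -addSn /mkseq iotaD !map_cat perm_cat//.
suff -> : map x (iota (0 + m.+1) (m' - m)) = map y (iota (0 + m.+1) (m' - m)) by [].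
by apply/eq_in_map => k; rewrite mem_iota => /andP[mk _]; apply: tl; lia.
Qed.

(** [key K] reads one symbol more than the first [K]. Going right, this symbol belongs to the common
    tail; going left, the bound is raised to [K.+1]. *)
Lemma S_relP x y : S_rel x y <->
  exists K, key K x = key K y /\ forall k, (K <= k)%N -> x k = y k.
Proof.
split=> [[K [tl pm]]|[K [/keyP[pm _] tl]]].
  exists K; split => //; apply/keyP; split; last exact: tl.
  by rewrite !mkseqS -!cats1 tl// perm_cat2r.
by exists K.+1; split => // k Kk; apply: tl; exact: ltnW.
Qed.

Lemma S_rel_refl x : S_rel x x.
Proof. by exists 0%N. Qed.

Lemma S_rel_sym x y : S_rel x y -> S_rel y x.
Proof. by move=> [K [tl pm]]; exists K; split => [k Kk|]; rewrite ?tl// perm_sym. Qed.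

Lemma S_rel_trans x y z : S_rel x y -> S_rel y z -> S_rel x z.
Proof.
move=> /S_relP[K [k1 t1]] /S_relP[L [k2 t2]]; apply/S_relP; exists (maxn K L); split.
  rewrite (key_trans (leq_maxl K L) k1 t1).
  exact: (key_trans (leq_maxr K L) k2 t2).
by move=> k; rewrite geq_max => /andP[Kk Lk]; rewrite t1// t2.
Qed.

Lemma S_rel_key x y : S_rel x y ->
  exists K, forall m, (K <= m)%N -> key m x = key m y /\ x m = y m.
Proof.
move=> /S_relP[K [kxy tl]]; exists K => m Km; split; last exact: tl.
exact: key_trans kxy tl.
Qed.

End SymbolCounts.

(** * The order on the classes and the finiteness of its intervals *)

Section ReverseLexicographicOrder.
Context (n : nat).
Implicit Types x y z : nat -> 'I_n.+1.
Lemma prec_trans x y z : prec x y -> prec y z -> prec x z.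
Proof.
move=> [m [xy txy]] [l [yz tyz]]; exists (maxn m l).
have [ml|lm|ml] := ltngtP m l.
- by rewrite txy//; split => // k lk; rewrite txy ?tyz//; exact: ltn_trans lk.
- by rewrite -tyz//; split => // k mk; rewrite txy ?tyz//; exact: ltn_trans mk.
- by rewrite ml in xy txy *; split; [exact: ltn_trans xy yz|move=> k lk; rewrite txy ?tyz].
Qed.

Lemma prec_total K x y : (forall k, (K <= k)%N -> x k = y k) ->
  x =1 y \/ prec x y \/ prec y x.
Proof.
elim: K => [|K IH] tl; first by left => k; exact: tl.
have [xy|yx|xy] := ltngtP (x K) (y K).
- by right; left; exists K.
- by right; right; exists K; split => // k Kk; rewrite tl.
- apply: IH => k; rewrite leq_eqVlt => /orP[/eqP<-|]; last exact: tl.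
  exact: val_inj.
Qed.

(** If one of the two last places of difference were at [K] or later, then at the larger of the two
    the strict inequalities would separate [x] from [y], which agree there. *)
Lemma prec_between K x y z : prec x z -> prec z y ->
  (forall k, (K <= k)%N -> x k = y k) -> forall k, (K <= k)%N -> x k = z k.
Proof.
move=> [m [xz txz]] [l [zy tzy]] tl k Kk; have [mk|km] := ltnP m k; first exact: txz.
have Km := leq_trans Kk km; exfalso.
have [ml|lm|ml] := ltngtP m l.
- by move: zy; rewrite -txz// tl ?ltnn//; exact: leq_trans (ltnW ml).
- by move: xz; rewrite tzy// tl// ltnn.
- by rewrite -ml in zy; have := ltn_trans xz zy; rewrite tl// ltnn.
Qed.

(** The integer with base n + 1 digits x_0, ..., x_(K-1), the last being the most significant. Among
    sequences with a common tail from [K] on it is strictly increasing for [prec], so it serves as a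
    measure of descent. *)
Definition rank K x := (\sum_(k < K) x k * n.+1 ^ k)%N.

Lemma rank_ub K x : (rank K x < n.+1 ^ K)%N.
Proof.
elim: K => [|K IH]; first by rewrite /rank big_ord0.
rewrite /rank big_ord_recr /= -/(rank K x) expnS.
have xK : (x K * n.+1 ^ K <= n * n.+1 ^ K)%N by rewrite leq_mul2r -ltnS ltn_ord orbT.
by rewrite mulSn -addSn leq_add.
Qed.

Lemma rank_lt K x y : prec x y -> (forall k, (K <= k)%N -> x k = y k) ->
  (rank K x < rank K y)%N.
Proof.
move=> [m [xy txy]]; elim: K => [|K IH] tl; first by rewrite tl ?ltnn in xy.
rewrite /rank !big_ord_recr /= -/(rank K x) -/(rank K y).
have [Km|mK|mK] := ltngtP K m; first by rewrite tl ?ltnn in xy.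
  rewrite txy// ltn_add2r; apply: IH => k; rewrite leq_eqVlt => /orP[/eqP<-|].
    exact: txy.
  exact: tl.
rewrite mK; apply: (@leq_trans ((x m).+1 * n.+1 ^ m)%N).
  by rewrite mulSn -addSn leq_add2r rank_ub.
by rewrite (leq_trans (leq_mul xy (leqnn _)))// leq_addl.
Qed.
End ReverseLexicographicOrder.

(** * The Markov measure: positivity, exchange of prefixes, independence of past and future *)

Section MarkovMeasure.
Context n (A : 'M[nat]_n.+1) (A01 : zero_one_mx A) (Airr : irreducible_mx A).
Local Notation X := (shift_space A01 Airr).
Context (R : realType) (P : 'M[R]_n.+1) (Pstoch : stochastic_mx P)
  (PA : compatible_mx P A) (p : 'rV[R]_n.+1) (pprob : probability_vector p)
  (pP : p *m P = p) (mu : probability X R) (muP : is_markov_measure P p mu).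
Implicit Types (x y z : X) (Q B C G : set X) (v w : nat -> 'I_n.+1).
Local Notation pr := (pr mu).
Local Notation cyl := (@cyl n A A01 Airr).
Local Notation det := (@det n A A01 Airr).

Definition mass m v : R := p 0 (v 0%N) * \prod_(k < m) P (v k) (v k.+1).

Lemma pr_cyl m v : pr (cyl m v) = mass m v.
Proof.
rewrite /pr (_ : cyl m v = [set x : X | forall k, (k <= m)%N -> x (0 + k)%N = v k])//.
by rewrite muP.
Qed.

(** Some symbol [k] has positive weight; stationarity carries positivity along admissible paths, and
    irreducibility provides one from [k] to [i]. *)
Lemma p_gt0 i : 0 < p 0 i.
Proof.
have [p0 p1] := pprob; have [P0 _] := Pstoch.
have [k pk] : exists k, 0 < p 0 k.
  apply/not_existsP => pn.
  have /eqP : \sum_i p 0 i = 0.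
    by apply: big1 => k _; apply/eqP; rewrite eq_le p0 andbT leNgt; apply/negP.
  by rewrite p1 oner_eq0.
have [m _ +] := Airr k i.
elim: m => [|m IH] in i *.
  by rewrite expr0 mxE; case: eqP => [<-|].
rewrite exprSr mxE lt0n => Am.
have [j] : exists j, (0 < (A ^+ m) k j * A j i)%N.
  apply/not_existsP => An; move/eqP: Am; apply; apply: big1 => j _.
  by apply/eqP; rewrite eqn0Ngt; apply/negP; exact: An.
rewrite muln_gt0 => /andP[/IH pj Aji].
have Pji : 0 < P j i by apply/PA; have [Aji0|//] := A01 j i; rewrite Aji0 in Aji.
rewrite -pP mxE (bigD1 j)//= ltr_wpDr ?mulr_gt0// sumr_ge0// => l _.
by rewrite mulr_ge0.
Qed.

Lemma mass_gt0 m v : (forall k, (k < m)%N -> A (v k) (v k.+1) = 1%N) -> 0 < mass m v.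
Proof.
move=> Av; rewrite mulr_gt0 ?p_gt0// prodr_gt0// => k _; apply/PA/Av.
exact: ltn_ord.
Qed.

Lemma pr_cyl_gt0 m x : 0 < pr (cyl m x).
Proof. by rewrite pr_cyl mass_gt0// => k _; exact: shift_space_admissible. Qed.

Lemma eq_mass m v w : (forall k, (k <= m)%N -> v k = w k) -> mass m v = mass m w.
Proof.
move=> vw; rewrite /mass vw//; congr (_ * _); apply: eq_bigr => k _.
by rewrite !vw ?ltn_ord// ltnW// ltn_ord.
Qed.

Lemma massD a c v :
  mass (a + c) v = mass a v * \prod_(j < c) P (v (a + j)%N) (v (a + j).+1).
Proof. by rewrite /mass big_split_ord mulrA. Qed.

Definition splice a w b v : nat -> 'I_n.+1 :=
  fun k => if (k < a)%N then w k else v (k - a + b)%N.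

Lemma splice_lt a w b v k : (k < a)%N -> splice a w b v k = w k.
Proof. by rewrite /splice => ->. Qed.

Lemma splice_ge a w b v k : splice a w b v (a + k) = v (b + k)%N.
Proof. by rewrite /splice ltnNge leq_addr /= addKn addnC. Qed.

Lemma splice_le a w b v k : w a = v b -> (k <= a)%N -> splice a w b v k = w k.
Proof.
move=> wv; rewrite leq_eqVlt => /orP[/eqP->|]; last exact: splice_lt.
by rewrite -[X in splice _ _ _ _ X]addn0 splice_ge addn0.
Qed.

Lemma splice_exists a w b y : (forall k, (k < a)%N -> A (w k) (w k.+1) = 1%N) ->
  w a = y b -> exists x, cyl a w x /\ forall k, x (a + k)%N = y (b + k)%N.
Proof.
move=> Aw wy; have [|x xE] := @shift_space_exists n A A01 Airr (splice a w b y).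
  move=> k; have [ka|ak] := ltnP k a.
    by rewrite !splice_le// ?Aw// ltnW.
  rewrite -(subnKC ak) -addnS !splice_ge addnS; exact: shift_space_admissible.
exists x; split => [k ka|k]; by rewrite xE ?splice_ge ?splice_le.
Qed.

(** The image of the part of [B] in [cyl a w] when the prefix [w] is replaced by [w']. The lengths
    may differ, which is what allows the first symbol to be removed later. *)
Definition prefix_swap a w b w' B : set X := [set y | cyl b w' y /\
  exists x, [/\ B x, cyl a w x & forall k, x (a + k)%N = y (b + k)%N]].

Lemma prefix_swap_uniq a w x x' y b : cyl a w x -> cyl a w x' ->
  (forall k, x (a + k)%N = y (b + k)%N) -> (forall k, x' (a + k)%N = y (b + k)%N) ->
  x = x'.
Proof.
move=> xw xw' t t'; apply: shift_space_ext => k.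
have [ka|ak] := ltnP k a; first by rewrite (xw _ (ltnW ka)) (xw' _ (ltnW ka)).
by rewrite -(subnKC ak) t t'.
Qed.

(* By the Markov property, prepending different words with the same last
   symbol multiplies the measure by a constant. *)
Lemma pr_prefix_swap a w b w' B :
  (forall k, (k < a)%N -> A (w k) (w k.+1) = 1%N) ->
  (forall k, (k < b)%N -> A (w' k) (w' k.+1) = 1%N) ->
  w a = w' b -> measurable B ->
  measurable (prefix_swap a w b w' B) /\
  pr (prefix_swap a w b w' B) * mass a w = pr (B `&` cyl a w) * mass b w'.
Proof.
move=> Aw Aw' ww'; have mcyl m v : measurable (cyl m v) := cyl_measurable m v.
have ex y : cyl b w' y -> exists x, cyl a w x /\ forall k, x (a + k)%N = y (b + k)%N.
  by move=> yw'; apply: splice_exists => //; rewrite ww' yw'.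
have full B' : cyl a w `<=` B' -> prefix_swap a w b w' B' = cyl b w'.
  move=> wB; apply/seteqP; split => y; first by case.
  by move=> yw'; split => //; have [x [xw xy]] := ex y yw'; exists x; split => //; apply: wB.
have empty B' : B' `&` cyl a w = set0 -> prefix_swap a w b w' B' = set0.
  move=> wB; apply/seteqP; split => y //= [_ [x [Bx wx _]]].
  by have : (B' `&` cyl a w) x by []; rewrite wB.
move: B; apply: borel_ind => [|m v|B mB [mS SE]|F mF tF IH].
- by rewrite empty ?set0I// pr_set0 !mul0r.
(* A cylinder of length at most that of [w] either contains [cyl a w] or misses it. A longer one
   misses it or lies inside it, and in the latter case its image is the spliced cylinder. *)
- have [ma|am] := leqP m a.
    have [vw|vw] := pselect (forall k, (k <= m)%N -> v k = w k).
      have wv : cyl a w `<=` cyl m v.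
        by move=> x xw k km; rewrite vw// xw// (leq_trans km).
      by rewrite full// setIidr// !pr_cyl mulrC.
    have wv : cyl m v `&` cyl a w = set0.
      apply/seteqP; split => x //= [xv xw]; apply: vw => k km.
      by rewrite -xv// xw// (leq_trans km).
    by rewrite empty// wv pr_set0 !mul0r.
  have [vw|vw] := pselect (forall k, (k <= a)%N -> v k = w k); last first.
    have wv : cyl m v `&` cyl a w = set0.
      apply/seteqP; split => x //= [xv xw]; apply: vw => k ka.
      by rewrite -xv ?xw// (leq_trans ka)// ltnW.
    by rewrite empty// wv pr_set0 !mul0r.
  rewrite -(subnKC (ltnW am)); set c := (m - a)%N.
  have va : w' b = v a by rewrite vw.
  have -> : cyl (a + c) v `&` cyl a w = cyl (a + c) v.
    apply: setIidl => x xv k ka; rewrite xv ?vw//.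
    by rewrite (leq_trans ka)// leq_addr.
  have -> : prefix_swap a w b w' (cyl (a + c) v) = cyl (b + c) (splice b w' a v).
    apply/seteqP; split => y.
      move=> [yw' [x [xv xw xy]]] k kbc; have [kb|bk] := ltnP k b.
        by rewrite splice_lt// (yw' _ (ltnW kb)).
      by rewrite -(subnKC bk) splice_ge -xy xv//; lia.
    move=> H; have yw' : cyl b w' y.
      move=> k kb; rewrite H ?splice_le//.
      by rewrite (leq_trans kb)// leq_addr.
    split => //; have [x [xw xy]] := ex y yw'; exists x; split => // k kac.
    have [ka|ak] := ltnP k a; first by rewrite xw ?vw// ltnW.
    rewrite -(subnKC ak) xy H ?splice_ge//; lia.
  split => //; rewrite !pr_cyl !massD (@eq_mass b _ w'); last first.
    by move=> k kb; rewrite splice_le.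
  rewrite (@eq_mass a v w)//.
  have -> : \prod_(j < c) P (splice b w' a v (b + j)) (splice b w' a v (b + j).+1) =
            \prod_(j < c) P (v (a + j)%N) (v (a + j).+1).
    by apply: eq_bigr => j _; rewrite -addnS !splice_ge addnS.
  ring.
(* The exchange is injective, so complements within [cyl a w] go to complements within
   [cyl b w']. *)
- have -> : prefix_swap a w b w' (~` B) = cyl b w' `\` prefix_swap a w b w' B.
    apply/seteqP; split => y.
      move=> [yw' [x [Bx xw xy]]]; split => // -[_ [x' [Bx' xw' xy']]].
      by apply: Bx; rewrite (prefix_swap_uniq xw xw' xy xy').
    move=> [yw' nS]; split => //; have [x [xw xy]] := ex y yw'.
    by exists x; split => // Bx; apply: nS; split => //; exists x.
  split; first exact: measurableD.
  have sub : cyl b w' `&` prefix_swap a w b w' B = prefix_swap a w b w' B.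
    by apply: setIidr => y [].
  have E1 := prIC mu (mcyl b w') mS; rewrite sub -setDE pr_cyl in E1.
  have E2 := prIC mu (mcyl a w) mB; rewrite pr_cyl in E2.
  rewrite [X in _ = pr X * _](_ : _ = cyl a w `&` ~` B); last exact: setIC.
  rewrite (_ : B `&` cyl a w = cyl a w `&` B) in SE; last exact: setIC.
  have -> : pr (cyl b w' `\` prefix_swap a w b w' B) =
    mass b w' - pr (prefix_swap a w b w' B) by rewrite {1}E1 addrAC subrr add0r.
  have -> : pr (cyl a w `&` ~` B) = mass a w - pr (cyl a w `&` B).
    by rewrite {1}E2 addrAC subrr add0r.
  by rewrite mulrBl SE; ring.
- have -> : prefix_swap a w b w' (\bigcup_k F k) = \bigcup_k prefix_swap a w b w' (F k).
    apply/seteqP; split => y.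
      by move=> [yw' [x [[k _ Fx] xw xy]]]; exists k => //; split => //; exists x.
    by move=> [k _ [yw' [x [Fx xw xy]]]]; split => //; exists x; split => //; exists k.
  have mS k : measurable (prefix_swap a w b w' (F k)) by case: (IH k).
  split; first exact: bigcupT_measurable.
  have tS : trivIset setT (fun k => prefix_swap a w b w' (F k)).
    apply/trivIsetP => i j _ _ ij; apply/seteqP; split => y //=.
    move=> [[_ [x [Fx xw xy]]] [_ [x' [Fx' xw' xy']]]].
    move/trivIsetP: tF => /(_ i j I I ij) FF.
    have : (F i `&` F j) x by split => //; rewrite (prefix_swap_uniq xw xw' xy xy').
    by rewrite FF.
  have mFw k : measurable (F k `&` cyl a w) by exact: measurableI.
  have tFw : trivIset setT (fun k => F k `&` cyl a w) by exact: trivIset_setIr.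
  have c1 : (fun N => (\sum_(0 <= k < N) pr (prefix_swap a w b w' (F k))) * mass a w) @ \oo
      --> pr (\bigcup_k prefix_swap a w b w' (F k)) * mass a w.
    by apply: cvgM; [exact: pr_bigcup_cvg|exact: cvg_cst].
  have c2 : (fun N => (\sum_(0 <= k < N) pr (F k `&` cyl a w)) * mass b w') @ \oo
      --> pr (\bigcup_k (F k `&` cyl a w)) * mass b w'.
    by apply: cvgM; [exact: pr_bigcup_cvg|exact: cvg_cst].
  rewrite setI_bigcupl; apply/eqP; rewrite eq_sym -(cvg_lim _ c2)// -(cvg_lim _ c1)//.
  apply/eqP; congr (lim (_ @ \oo)); apply/funext => N.
  by rewrite !big_distrl; apply: eq_bigr => k _; case: (IH k).
Qed.

Lemma mass_shift_gt0 m x : 0 < mass m x.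
Proof. by apply: mass_gt0 => k _; exact: shift_space_admissible. Qed.

(** The coordinates up to [m] enter only through their [key]. Examples are sets invariant under
    [S_rel] and statements about counts at later times. *)
Definition future_event m B := forall x y, key m x = key m y ->
  (forall k, (m <= k)%N -> x k = y k) -> B x -> B y.

Definition key_class m c : set X := [set x | key m x = c].

Arguments key_class m c : clear implicits.

Lemma key_class_det m c : det m (key_class m c).
Proof. by move=> x y xy; rewrite /key_class /= (key_eq xy). Qed.

(** Exchanging the prefix of [x] for that of [y] preserves [B], so the conditional probability of
    [B] given a prefix depends only on the key of the prefix. *)
Lemma future_event_swap m B x y : measurable B -> future_event m B -> key m x = key m y ->
  pr (B `&` cyl m y) * mass m x = pr (B `&` cyl m x) * mass m y.
Proof.
move=> mB iB kxy; have [_ xy] := (keyP m x y).1 kxy.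
have adm u k : (k < m)%N -> A ((u : X) k) (u k.+1) = 1%N.
  by move=> _; exact: shift_space_admissible.
have [_ <-] := pr_prefix_swap (adm x) (adm y) xy mB.
congr (pr _ * _); apply/seteqP; split => z.
  move=> [Bz zy]; split => //.
  have [|x' [x'x tl]] := @splice_exists m x m z (adm x).
    by rewrite xy zy.
  exists x'; split => //; apply: iB Bz.
    by rewrite (key_eq x'x) (key_eq zy).
  by move=> k mk; rewrite -(subnKC mk) tl.
move=> [zy [x' [Bx' x'x tl]]]; split => //; apply: iB Bx'.
  by rewrite (key_eq x'x) (key_eq zy).
by move=> k mk; rewrite -(subnKC mk) tl.
Qed.

(* Conditionally on the symbol counts and the last symbol of a prefix, the past
   is independent of the events that only see the future and these counts. *)
Lemma future_event_class m B c : measurable B -> future_event m B -> exists2 d, 0 <= d &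
  forall C, det m C -> pr (C `&` B `&` key_class m c) = d * pr (C `&` key_class m c).
Proof.
move=> mB iB; have [E0|/set0P[z Ez]] := eqVneq (key_class m c) set0.
  by exists 0 => // C _; rewrite E0 !setI0 pr_set0 mulr0.
have mz := mass_shift_gt0 m z.
(* The conditional probability of [B] given the prefix of an arbitrary point of the class. *)
exists (pr (B `&` cyl m z) / mass m z) => [|C dC].
  by rewrite divr_ge0 ?pr_ge0// ltW.
set d := (X in X * _).
have dE := @key_class_det m c.
have mC := det_measurable dC; have mE := det_measurable dE.
have mw u : measurable [set x : X | word m x = u].
  by rewrite word_fiber; exact: cyl_measurable.
rewrite (pr_fibers mu mw); last by apply: measurableI => //; exact: measurableI.
rewrite [in RHS](pr_fibers mu mw); last exact: measurableI.
rewrite big_distrr /=; apply: eq_bigr => w _.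
have [[y [[Cy Ey] yw]]|none] := pselect ((C `&` key_class m c `&` [set x | word m x = w]) !=set0).
  have wy : [set x : X | word m x = w] = cyl m y.
    by rewrite word_fiber; apply/seteqP; split => x H k km; rewrite H// -yw word_seqK.
  have yC : cyl m y `<=` C `&` key_class m c.
    by move=> x xy; split; [apply: dC Cy|apply: dE Ey] => k km; rewrite xy.
  rewrite wy (setIidr yC) (_ : C `&` B `&` _ `&` _ = B `&` cyl m y); last first.
    apply/seteqP; split => x; first by move=> [[[_ Bx] _] xy].
    by move=> [Bx xy]; have [Cx Ex] := yC x xy.
  rewrite pr_cyl /d; apply: (mulIf (lt0r_neq0 mz)).
  rewrite (future_event_swap mB iB (_ : key m z = key m y)).
    by rewrite mulrAC divfK ?gt_eqF.
  by rewrite Ez Ey.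
rewrite (_ : C `&` B `&` _ `&` _ = set0).
  rewrite (_ : C `&` _ `&` _ = set0) ?pr_set0 ?mulr0//.
  by apply/seteqP; split => x //= H; apply: none; exists x.
by apply/seteqP; split => x //= [[[Cx _] Ex] wx]; apply: none; exists x.
Qed.

(** Within one key class, intersecting with [G] multiplies both sides by the same factor from
    [future_event_class]; then the classes are summed. *)
Lemma class_le m C1 C2 G lam : det m C1 -> det m C2 -> measurable G -> future_event m G ->
  (forall c, lam * pr (C1 `&` key_class m c) <= pr (C2 `&` key_class m c)) ->
  lam * pr (C1 `&` G) <= pr (C2 `&` G).
Proof.
move=> d1 d2 mG iG H.
have mE c : measurable (key_class m c) by apply: det_measurable; exact: key_class_det.
rewrite (pr_fibers mu mE (measurableI _ _ (det_measurable d1) mG)).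
rewrite (pr_fibers mu mE (measurableI _ _ (det_measurable d2) mG)) big_distrr /=.
apply: ler_sum => c _; have [d d0 dE] := future_event_class c mG iG.
by rewrite !dE// mulrCA; exact: ler_wpM2l.
Qed.

Lemma pr_follow m L C v : det m C -> C `<=` [set x | x m = v 0%N] ->
  pr (C `&` [set x | forall k, (k <= L)%N -> x (m + k)%N = v k]) =
  pr C * \prod_(k < L) P (v k) (v k.+1).
Proof.
move=> dC Cv; have mC := det_measurable dC.
set F := [set x | _]; have dF : det (m + L) F.
  by move=> x y xy Fx k kL; rewrite -xy ?Fx// leq_add2l.
have mF := det_measurable dF.
have mw u : measurable [set x : X | word m x = u].
  by rewrite word_fiber; exact: cyl_measurable.
rewrite (pr_fibers mu mw); last exact: measurableI.
rewrite [in RHS](pr_fibers mu mw)// big_distrl; apply: eq_bigr => w _ /=.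
have [[y [Cy yw]]|none] := pselect ((C `&` [set x | word m x = w]) !=set0).
  have wy : [set x : X | word m x = w] = cyl m y.
    by rewrite word_fiber; apply/seteqP; split => x H k km; rewrite H// -yw word_seqK.
  have yC : cyl m y `<=` C by move=> x xy; apply: dC Cy => k km; rewrite xy.
  rewrite wy (setIidr yC) pr_cyl.
  have yv : y m = v 0%N by exact: Cv.
  have -> : C `&` F `&` cyl m y = cyl (m + L) (splice m y 0 v).
    apply/seteqP; split => x.
      move=> [[_ Fx] xy] k kmL; have [km|mk] := ltnP k m.
        by rewrite splice_lt ?xy// ltnW.
      by rewrite -(subnKC mk) splice_ge Fx//; lia.
    move=> H; have xy : cyl m y x.
      by move=> k km; rewrite H ?splice_le//; lia.
    split => //; split; first exact: yC.
    by move=> k kL; rewrite H ?splice_ge ?leq_add2l.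
  rewrite pr_cyl massD (@eq_mass m _ y); last by move=> k km; rewrite splice_le.
  by congr (_ * _); apply: eq_bigr => j _; rewrite -addnS !splice_ge.
rewrite (_ : _ `&` _ `&` _ = set0).
  rewrite (_ : C `&` _ = set0) ?pr_set0 ?mul0r//.
  by apply/seteqP; split => x //= H; apply: none; exists x.
by apply/seteqP; split => x //= [[Cx _] wx]; apply: none; exists x.
Qed.

(** * Ratio limits with the last symbol *)

Definition past_class m x := key_class m (key m x).

Lemma past_classE m x :
  count_set (psi0 m.+1 x) m `&` symbol_set (x m) m = past_class m x.
Proof.
apply/seteqP; split => y /=; first by move=> [c s]; apply/key_psi0.
by move=> /key_psi0[].
Qed.

Lemma past_class_det m x : det m (past_class m x).
Proof. exact: key_class_det. Qed.

Lemma past_class_measurable m x : measurable (past_class m x).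
Proof. by have H := @past_class_det m x; exact: det_measurable H. Qed.

Lemma past_class_gt0 m x : 0 < pr (past_class m x).
Proof.
apply: lt_le_trans (pr_cyl_gt0 m x) _; apply: pr_le.
- exact: cyl_measurable.
- exact: past_class_measurable.
- by move=> y yx; exact: key_eq.
Qed.

Definition key_invariant m Q := forall x y, key m x = key m y -> Q x -> Q y.

Lemma past_class_key m x y : key m x = key m y -> past_class m x = past_class m y.
Proof. by rewrite /past_class => ->. Qed.

Lemma key_invariant_det m Q : key_invariant m Q -> det m Q.
Proof. by move=> kQ x y xy; apply: kQ; exact: key_eq. Qed.

Lemma key_invariant_inv m m' Q : (m <= m')%N -> key_invariant m' Q -> future_event m Q.
Proof. by move=> mm kQ x y kxy tl; apply: kQ; exact: key_trans mm kxy tl. Qed.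

Lemma word_le m V S1 S2 (c1 c2 : R) : det m V -> measurable S1 -> measurable S2 ->
  (forall x, V x -> c1 * pr (S1 `&` cyl m x) <= c2 * pr (S2 `&` cyl m x)) ->
  c1 * pr (S1 `&` V) <= c2 * pr (S2 `&` V).
Proof.
move=> dV mS1 mS2 H; have mV := det_measurable dV.
have mw u : measurable [set x : X | word m x = u].
  by rewrite word_fiber; exact: cyl_measurable.
rewrite (pr_fibers mu mw (measurableI _ _ mS1 mV)) big_distrr.
rewrite (pr_fibers mu mw (measurableI _ _ mS2 mV)) big_distrr /=.
apply: ler_sum => u _.
have [[y [Vy yu]]|none] := pselect ((V `&` [set x | word m x = u]) !=set0).
  have -> : [set x : X | word m x = u] = cyl m y.
    by rewrite word_fiber; apply/seteqP; split => x Hx k km; rewrite Hx// -yu word_seqK.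
  have yV : cyl m y `<=` V by move=> x xy; apply: dV Vy => k km; rewrite xy.
  by rewrite -!setIA !(setIidr yV) H.
by rewrite -!setIA (_ : V `&` _ = set0) ?setI0 ?pr_set0 ?mulr0//;
  apply/seteqP; split => x //= Hx; apply: none; exists x.
Qed.

(* The last time at which Q occurs before a given horizon only depends on the
   counts up to that time and on the future, so class_le applies to its level sets. *)
Lemma maximal_inequality N (Q C : nat -> set X) U lam : 0 <= lam ->
  measurable U -> (forall m, key_invariant m (Q m)) -> (forall m, det m (C m)) ->
  (forall m, (N <= m)%N -> C m `<=` U) ->
  (forall m x, (N <= m)%N -> Q m x ->
     lam * pr (past_class m x) <= pr (C m `&` past_class m x)) ->
  lam * pr (\bigcup_(m in [set m | (N <= m)%N]) Q m) <= pr U.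
Proof.
move=> lam0 mU kQ dC CU H.
have mQ m : measurable (Q m) by apply: det_measurable; exact: key_invariant_det.
have -> : \bigcup_(m in [set m | (N <= m)%N]) Q m = \bigcup_k Q (N + k)%N.
  apply/seteqP; split => x.
    by move=> [m /= Nm Qm]; exists (m - N)%N => //; rewrite subnKC.
  by move=> [k _ Qk]; exists (N + k)%N => //=; rewrite leq_addr.
apply: last_index_cover; [exact: lam0|exact: mU|by move=> k; exact: mQ|move=> k M V VE].
pose B := \bigcup_(j in [set j | (k < j < M)%N]) Q (N + j)%N.
have mB : measurable B by exact: bigcup_measurable.
have iB : future_event (N + k) (~` B).
  move=> x y kxy tl; apply: contra_not => -[j /= jk Qj]; exists j => //.
  move: Qj; apply: (@key_invariant_inv (N + k)%N _ _ _ (@kQ _)) => //; first by lia.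
  by move=> i Ni; rewrite tl.
rewrite -[\bigcup_(j in _) _]/B setDE in VE.
have mCQ : measurable (C (N + k)%N `&` Q (N + k)%N).
  by apply: measurableI => //; exact: det_measurable (dC _).
apply: (@le_trans _ _ (pr (C (N + k)%N `&` Q (N + k)%N `&` ~` B))).
  rewrite VE; apply: (@class_le (N + k)%N).
  - exact: key_invariant_det.
  - by apply: detI => //; exact: key_invariant_det.
  - exact: measurableC.
  - exact: iB.
  move=> c; have [[x [Qx cx]]|none] := pselect ((Q (N + k)%N `&` key_class (N + k) c) !=set0).
    rewrite -setIA; have -> : Q (N + k)%N `&` key_class (N + k) c = past_class (N + k) x.
      rewrite /past_class cx; apply: setIidr => y yc; apply: kQ Qx.
      by rewrite cx yc.
    by apply: H => //; rewrite leq_addr.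
  rewrite -setIA (_ : Q _ `&` _ = set0) ?setI0 ?pr_set0 ?mulr0//.
  by apply/seteqP; split => x //= Hx; apply: none; exists x.
apply: pr_le.
- by apply: measurableI => //; exact: measurableC.
- by rewrite VE; apply: measurableI => //; apply: measurableI => //; exact: measurableC.
- move=> x [[Cx Qx] Bx]; rewrite VE; split; last by [].
  by apply: CU Cx; rewrite leq_addr.
Qed.

Lemma infinitely_often_nullU (Q Q1 Q2 : nat -> set X) :
  (forall m, measurable (Q m)) -> (forall m, measurable (Q1 m)) ->
  (forall m, measurable (Q2 m)) -> (forall m, Q m `<=` Q1 m `|` Q2 m) ->
  pr (infinitely_often Q1) = 0 -> pr (infinitely_often Q2) = 0 ->
  pr (infinitely_often Q) = 0.
Proof.
move=> mQ mQ1 mQ2 H H1 H2; apply/eqP; rewrite eq_le pr_ge0 andbT.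
have m1 := infinitely_often_measurable mQ1.
have m2 := infinitely_often_measurable mQ2.
have := prU_le mu m1 m2; rewrite H1 H2 addr0; apply: le_trans; apply: pr_le.
- exact: infinitely_often_measurable.
- exact: measurableU.
move=> x Qx; have [|n1] := pselect (infinitely_often Q1 x); [by left|right => N].
have /existsNP[K HK] := n1.
have [m] := Qx (maxn N K); rewrite geq_max => /andP[Nm Km] /H[Q1m|Q2m].
  by case: HK; exists m.
by exists m.
Qed.

Section FirstLimit.
Context (Serg : ergodic_S mu).

Lemma ergodic_zero_one B : measurable B -> (forall x y, S_rel x y -> B x -> B y) ->
  pr B = 0 \/ pr B = 1.
Proof.
move=> mB iB; have BE : S_saturation B = B.
  apply/seteqP; split => x; last by exists x => //; exact: S_rel_refl.
  by move=> [y By xy]; apply: iB By; exact: S_rel_sym.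
have := Serg mB; rewrite BE => -[] /measure_negligible H; [left|right].
  by rewrite /pr H.
have := prC mu mB; rewrite {1}/pr H//; last exact: measurableC.
by rewrite /= => H1; lra.
Qed.

(** Equivalent points have equal keys at all late times, so the upper limit of these events is
    invariant. *)
Lemma infinitely_often_zero_one (Q : nat -> set X) : (forall m, key_invariant m (Q m)) ->
  pr (infinitely_often Q) = 0 \/ pr (infinitely_often Q) = 1.
Proof.
move=> kQ; apply: ergodic_zero_one.
  by apply: infinitely_often_measurable => m; apply: det_measurable; exact: key_invariant_det.
move=> x y /S_rel_key[K HK] Qx N.
have [m] := Qx (maxn N K); rewrite geq_max => /andP[Nm Km] Qm; exists m => //.
by have [kxy _] := HK m Km; apply: kQ Qm.
Qed.

(** Otherwise the upper limit has probability one, hence so does the union of the [Q m] from [N] on,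
    and the maximal inequality gives [lam <= pr U]. *)
Lemma maximal_null N (Q C : nat -> set X) U lam : 0 <= lam ->
  measurable U -> (forall m, key_invariant m (Q m)) -> (forall m, det m (C m)) ->
  (forall m, (N <= m)%N -> C m `<=` U) ->
  (forall m x, (N <= m)%N -> Q m x ->
     lam * pr (past_class m x) <= pr (C m `&` past_class m x)) ->
  pr U < lam -> pr (infinitely_often Q) = 0.
Proof.
move=> lam0 mU kQ dC CU H Ulam.
have [//|Q1] := infinitely_often_zero_one kQ.
have mQ m : measurable (Q m) by apply: det_measurable; exact: key_invariant_det.
have := maximal_inequality lam0 mU kQ dC CU H.
have := infinitely_often_le mu N mQ; rewrite Q1 => H1 H2.
have : lam * 1 <= pr U by apply: le_trans H2; exact: ler_wpM2l.
by rewrite mulr1 leNgt Ulam.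
Qed.

(** The conditional probability of [B] given the past class exceeds [lam], with the positive
    denominator cleared; [deviates] below is written in the same way. *)
Definition over B (lam : R) m : set X :=
  [set x | lam * pr (past_class m x) < pr (B `&` past_class m x)].

Lemma over_key B lam m : key_invariant m (over B lam m).
Proof. by move=> x y kxy; rewrite /over /= (past_class_key kxy). Qed.

Definition deviates B (e : R) m : set X :=
  [set x | e * pr (past_class m x) <
    `|pr (B `&` past_class m x) - pr B * pr (past_class m x)|].

Lemma deviates_key B e m : key_invariant m (deviates B e m).
Proof. by move=> x y kxy; rewrite /deviates /= (past_class_key kxy). Qed.

Lemma over_measurable B lam m : measurable (over B lam m).
Proof. by apply: det_measurable; apply: key_invariant_det; exact: over_key. Qed.

Lemma deviates_measurable B e m : measurable (deviates B e m).
Proof. by apply: det_measurable; apply: key_invariant_det; exact: deviates_key. Qed.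

Lemma over_det_null m0 B lam : det m0 B -> pr B < lam ->
  pr (infinitely_often (over B lam)) = 0.
Proof.
move=> dB Blam; have mB := det_measurable dB.
(* [C m] has to be determined at time [m], which holds for [B] only from [m0] on. *)
pose C m := if (m0 <= m)%N then B else set0.
apply: (@maximal_null m0 _ C B lam) => //.
- by apply: le_trans (ltW Blam); exact: pr_ge0.
- by move=> m; exact: over_key.
- by move=> m; rewrite /C; case: ifP => mm; [exact: detW dB|move=> ? ? _ []].
- by move=> m mm; rewrite /C mm.
- by move=> m x mm; rewrite /C mm => /ltW.
Qed.

Lemma pr_setC_class B m x : measurable B ->
  pr (~` B `&` past_class m x) = pr (past_class m x) - pr (B `&` past_class m x).
Proof.
move=> mB; have := prIC mu (past_class_measurable m x) mB.
by rewrite (setIC _ B) (setIC _ (~` B)) => H; lra.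
Qed.

Lemma deviates_det_null m0 B e : det m0 B -> 0 < e ->
  pr (infinitely_often (deviates B e)) = 0.
Proof.
move=> dB e0; have mB := det_measurable dB.
(* A deviation of [B] downwards is a deviation of its complement upwards. *)
apply: (@infinitely_often_nullU _ (over B (pr B + e)) (over (~` B) (pr (~` B) + e))).
- by move=> m; exact: deviates_measurable.
- by move=> m; exact: over_measurable.
- by move=> m; exact: over_measurable.
- move=> m x; rewrite /deviates /over /= pr_setC_class// prC//.
  have r0 := past_class_gt0 m x.
  by rewrite ltr_normr => /orP[H|H]; [left|right]; nra.
- by apply: over_det_null dB _; lra.
- by apply: over_det_null (detC dB) _; lra.
Qed.

(* The conditional probabilities of D given the prefixes exceed e / 2 only on a
   set U of measure at most 2 pr D / e (Doob's inequality), and outside U they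
   do not contribute more than e / 2. *)
Lemma over_small_null D e : measurable D -> 0 < e -> pr D < e * e / 4 ->
  pr (infinitely_often (over D e)) = 0.
Proof.
move=> mD e0 De; pose th := e / 2.
have th0 : 0 < th by rewrite /th; lra.
pose C m := [set x : X | th * pr (cyl m x) < pr (D `&` cyl m x)].
have dC m : det m (C m).
  move=> x y xy; rewrite /C /=; have -> // : cyl m x = cyl m y.
  by apply/seteqP; split => z H k km; rewrite H// xy.
have mC m := det_measurable (dC m).
pose U := \bigcup_m C m.
have mU : measurable U by exact: bigcupT_measurable.
have thU : th * pr U <= pr D.
  apply: first_index_cover; [exact: ltW|exact: mD|exact: mC|move=> m V VE].
  have dV : det m V.
    rewrite VE setDE; apply: detI => //; apply: detC; apply: det_bigcupP => k /= km.
    by apply: detW (dC k); exact: ltnW.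
  rewrite -{1}(setTI V) -[leRHS]mul1r; apply: (word_le dV) => // x; rewrite VE => -[Cx _].
  by rewrite mul1r setTI; exact: ltW.
apply: (@maximal_null 0 _ C U (e - th)) => //.
- by rewrite /th; lra.
- by move=> m; exact: over_key.
- by move=> m _ x Cx; exists m.
- move=> m x _; rewrite /over /=.
  have mE := past_class_measurable m x; set E := past_class m x in mE *.
  have mDE : measurable (D `&` E) by exact: measurableI.
  have H1 : pr (D `&` E `&` C m) <= pr (C m `&` E).
    by apply: pr_le; [exact: measurableI|exact: measurableI|move=> y [[_ ?] ?]].
  have H2 : 1 * pr (D `&` (E `&` ~` C m)) <= th * pr (setT `&` (E `&` ~` C m)).
    apply: (@word_le m) => //.
      by apply: detI; [exact: past_class_det|exact: detC].
    by move=> y [_ /negP]; rewrite mul1r setTI -leNgt.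
  rewrite setTI mul1r setIA in H2.
  have H3 : pr (E `&` ~` C m) <= pr E.
    by apply: pr_le => //; apply: measurableI => //; exact: measurableC.
  have H4 := prIC mu mDE (mC m).
  by move=> H; nra.
(* Since [pr D < th * th], Doob's bound gives [pr U < th], and [th] equals [e - th]. *)
- have : th * pr U <= th * th - (e * e / 4 - pr D) by rewrite /th in thU *; nra.
  rewrite /th; nra.
Qed.

(** Borel induction. Cylinders are determined at a finite time, and a set deviates exactly when its
    complement does. A disjoint union is cut into finitely many sets, treated by additivity, and a
    remainder [D] so small that [over_small_null] applies. *)
Lemma deviates_null B e : measurable B -> 0 < e -> pr (infinitely_often (deviates B e)) = 0.
Proof.
move=> mB; move: B mB e.
have null0 : forall e, 0 < e -> pr (infinitely_often (deviates set0 e)) = 0.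
  by move=> e; apply: (@deviates_det_null 0); move=> ? ? _ [].
have nullU : forall B C, measurable B -> measurable C -> B `&` C = set0 ->
    (forall e, 0 < e -> pr (infinitely_often (deviates B e)) = 0) ->
    (forall e, 0 < e -> pr (infinitely_often (deviates C e)) = 0) ->
    forall e, 0 < e -> pr (infinitely_often (deviates (B `|` C) e)) = 0.
  move=> B C mB mC BC HB HC e e0.
  apply: (@infinitely_often_nullU _ (deviates B (e / 2)) (deviates C (e / 2))).
  - by move=> m; exact: deviates_measurable.
  - by move=> m; exact: deviates_measurable.
  - by move=> m; exact: deviates_measurable.
  - move=> m x; rewrite /deviates /= setIUl prU//; first last.
    + by rewrite setIACA BC set0I.
    + by apply: measurableI => //; exact: past_class_measurable.
    + by apply: measurableI => //; exact: past_class_measurable.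
    rewrite prU//; set r := pr (past_class m x); set b := pr (B `&` _).
    set c := pr (C `&` _); set b' := pr B; set c' := pr C => H.
    apply/orP; rewrite -implyNb -leNgt; apply/implyP => H1; rewrite ltNge.
    apply/negP => H2; move: H; apply/negP; rewrite -leNgt.
    rewrite (_ : _ - _ = (b - b' * r) + (c - c' * r)); last by ring.
    by apply: le_trans (ler_normD _ _) _; lra.
  - by apply: HB; lra.
  - by apply: HC; lra.
apply: borel_ind => // [m v e|B mB HB e e0|F mF tF HF e e0].
- exact: deviates_det_null (det_cyl (v:=v)).
- rewrite -(HB e e0); congr (pr (infinitely_often _)); apply/funext => m.
  apply/funext => x; rewrite /deviates /= pr_setC_class// prC//.
  congr (is_true (_ < _)); rewrite -[RHS]normrN; congr (`|_|); ring.
pose G N := \bigcup_(k in `I_N) F k.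
have mG N : measurable (G N) by exact: bigcup_measurable.
have HG N : forall e, 0 < e -> pr (infinitely_often (deviates (G N) e)) = 0.
  elim: N => [|N IH]; first by rewrite /G bigcup_mkord big_ord0.
  have -> : G N.+1 = G N `|` F N by rewrite /G !bigcup_mkord big_ord_recr.
  apply: nullU => //; last by move=> e1; exact: HF.
  apply/seteqP; split => x //= [[k /= kN Fk] FN].
  have kN' : k != N by rewrite neq_ltn kN.
  by move/trivIsetP: tF => /(_ k N I I kN'); rewrite predeqE => /(_ x)[] /(_ (conj Fk FN)).
(* Disjoint sets have an empty upper limit, so the union of a late tail of [F] is arbitrarily
   small. *)
have F0 : pr (infinitely_often F) = 0.
  rewrite (_ : infinitely_often F = set0) ?pr_set0//.
  apply/seteqP; split => x // Fx; have [k _ Fk] := Fx 0%N; have [l kl Fl] := Fx k.+1.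
  have kl' : k != l by rewrite neq_ltn kl.
  by move/trivIsetP: tF => /(_ k l I I kl'); rewrite predeqE => /(_ x)[] /(_ (conj Fk Fl)).
(* The first bound keeps [pr D] itself below e / 3; the second is the smallness required by
   [over_small_null] at level e / 3. *)
pose d := Num.min (e / 3) (e / 3 * (e / 3) / 4).
have d0 : 0 < d by rewrite /d lt_min; apply/andP; split; nra.
have [K HK] := tail_union_small mF F0 d0.
set D := \bigcup_(m in _) F m in HK.
have mD : measurable D by exact: bigcup_measurable.
move: HK; rewrite /d lt_min => /andP[De3 De].
have FE : \bigcup_k F k = G K `|` D.
  apply/seteqP; split => x.
    by move=> [k _ Fk]; have [kK|Kk] := ltnP k K; [left|right]; exists k.
  by move=> [[k _ Fk]|[k _ Fk]]; exists k.
have GD : G K `&` D = set0.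
  apply/seteqP; split => x //= [[k /= kK Fk] [l /= Kl Fl]].
  have kl' : k != l by rewrite neq_ltn (leq_trans kK Kl).
  by move/trivIsetP: tF => /(_ k l I I kl'); rewrite predeqE => /(_ x)[] /(_ (conj Fk Fl)).
apply: (@infinitely_often_nullU _ (deviates (G K) (e / 3)) (over D (e / 3))).
- by move=> m; exact: deviates_measurable.
- by move=> m; exact: deviates_measurable.
- by move=> m; exact: over_measurable.
- move=> m x; rewrite /deviates /over /= FE setIUl prU//; first last.
  + by rewrite setIACA GD set0I.
  + by apply: measurableI => //; exact: past_class_measurable.
  + by apply: measurableI => //; exact: past_class_measurable.
  rewrite prU//; have dd0 := pr_ge0 mu D.
  have dr0 := pr_ge0 mu (D `&` past_class m x).
  have r0 := past_class_gt0 m x.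
  move: De3 dd0 dr0 r0; set r := pr (past_class m x); set b := pr (G K `&` _).
  set dr := pr (D `&` _); set b' := pr (G K); set dd := pr D.
  move=> de3 dd0 dr0 r0 H; apply/orP; rewrite -implyNb -leNgt; apply/implyP => H1; rewrite ltNge.
  apply/negP => H2; move: H; apply/negP; rewrite -leNgt.
  rewrite (_ : _ - _ = (b - b' * r) + (dr - dd * r)); last by ring.
  apply: le_trans (ler_normD _ _) _.
  have : `|dr - dd * r| <= e / 3 * r + e / 3 * r.
    by rewrite ler_norml; apply/andP; split; nra.
  by nra.
- by apply: HG; lra.
- by apply: over_small_null => //; lra.
Qed.

End FirstLimit.

(** * From symbol limits to ergodicity *)

(** Only countably many exchanges of prefixes occur: one for each time and each pair of words with
    the same key, and each has a measurable image. *)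
Lemma S_saturation_measurable B : measurable B -> measurable (S_saturation B).
Proof.
move=> mB.
pose D m : set ({ffun 'I_m.+1 -> 'I_n.+1} * {ffun 'I_m.+1 -> 'I_n.+1}) :=
  [set u | exists x y, [/\ word m x = u.1, word m y = u.2 & key m x = key m y]].
have -> : S_saturation B = \bigcup_m \bigcup_(u in D m)
    prefix_swap m (word_seq u.2) m (word_seq u.1) B.
  apply/seteqP; split => x.
    move=> [y By /S_relP[K [kxy tl]]]; exists K => //.
    exists (word K x, word K y); first by exists x, y.
    split => /=; first by move=> k kK; rewrite word_seqK.
    exists y; split => // [k kK|k]; first by rewrite word_seqK.
    by rewrite tl// leq_addr.
  move=> [m _ [[u u'] [x' [y' [/= ux uy kxy]]]]] [xu [y [By yu tl]]].
  exists y => //; apply/S_relP; exists m; split.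
    rewrite (@key_eq _ m x x') => [|k km]; last by rewrite xu// -ux word_seqK.
    rewrite (@key_eq _ m y y') => [//|k km]; by rewrite yu// -uy word_seqK.
  by move=> k mk; rewrite -(subnKC mk) tl.
apply: bigcupT_measurable => m; apply: fin_bigcup_measurable.
  exact: finite_finset.
move=> [u u'] [x [y [/= ux uy kxy]]]; have [_ xy] := (keyP m x y).1 kxy.
have adm (z : X) k : (k < m)%N -> A (word_seq (word m z) k) (word_seq (word m z) k.+1) = 1%N.
  by move=> km; rewrite !word_seqK ?shift_space_admissible// ltnW.
rewrite -ux -uy; apply: (pr_prefix_swap (adm y) (adm x) _ mB).1.
by rewrite !word_seqK.
Qed.

Lemma S_saturation_invariant B x y : S_rel x y -> S_saturation B x -> S_saturation B y.
Proof.
move=> xy [z Bz xz]; exists z => //; apply: S_rel_trans xz; exact: S_rel_sym.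
Qed.

Definition S_invariant B := forall x y, S_rel x y -> B x -> B y.

Lemma S_invariant_future m B : S_invariant B -> future_event m B.
Proof. by move=> iB x y kxy tl; apply: iB; apply/S_relP; exists m. Qed.

Lemma S_rel_cons (x x' y y' : nat -> 'I_n.+1) : x 0%N = x' 0%N ->
  (forall t, x t.+1 = y t) -> (forall t, x' t.+1 = y' t) -> S_rel y y' -> S_rel x x'.
Proof.
move=> x0 xy xy' [K [tl pm]]; exists K.+1; split.
  by case=> // k Kk; rewrite xy xy' tl.
have E (u u' : nat -> 'I_n.+1) : (forall t, u t.+1 = u' t) ->
    mkseq u K.+1 = u 0%N :: mkseq u' K.
  move=> uu; rewrite /mkseq /=; congr cons.
  by rewrite (iotaDl 1 0) -map_comp; apply: eq_map => t /=; rewrite -uu.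
by rewrite (E _ _ xy) (E _ _ xy') x0 perm_cons.
Qed.

Section IndependenceOfSymbols.
Context (symbol_limit : forall (i : 'I_n.+1) (e : R), 0 < e ->
  pr (infinitely_often (deviates (symbol_set i 0) e)) = 0).

Lemma symbol_det i : det 0 (symbol_set i 0).
Proof. by move=> x y xy; rewrite /symbol_set /= xy. Qed.

Lemma symbol_setE (v : nat -> 'I_n.+1) : symbol_set (v 0%N) 0 = cyl 0 v.
Proof.
apply/seteqP; split => x /=; first by move=> x0 k; rewrite leqn0 => /eqP ->.
by apply.
Qed.

Lemma pr_symbol i : pr (symbol_set i 0) = p 0 i.
Proof. by rewrite (symbol_setE (fun=> i)) pr_cyl /mass big_ord0 mulr1. Qed.

Lemma pr_sum_symbol B : measurable B -> \sum_i pr (symbol_set i 0 `&` B) = pr B.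
Proof.
move=> mB; have ms i : measurable [set x : X | x 0%N = i].
  exact: det_measurable (@symbol_det i).
by rewrite [RHS](pr_fibers mu ms)//; apply: eq_bigr => i _; rewrite setIC.
Qed.

(** An invariant set is a future event at every time. Off the event [Q] of deviation at one late
    time [N], the bound on the conditional probability of the symbol therefore passes to [B] by
    [class_le]. *)
Lemma symbol_indep_ge B i : measurable B -> S_invariant B ->
  p 0 i * pr B <= pr (symbol_set i 0 `&` B).
Proof.
(* One half of [e0] pays for the tolerance in the conditional probability, the other for the measure
   of [Q]. *)
move=> mB iB; apply/ler_addgt0Pr => e0 e00; pose e := e0 / 2.
have e_gt0 : 0 < e by rewrite /e; lra.
have mD m : measurable (deviates (symbol_set i 0) e m) by exact: deviates_measurable.
have [N HN] := tail_union_small mD (symbol_limit i e_gt0) e_gt0.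
pose Q := deviates (symbol_set i 0) e N.
have QN : pr Q < e.
  apply: le_lt_trans HN; apply: pr_le; [exact: mD|exact: bigcup_measurable|].
  by move=> x Qx; exists N => //=.
have mQ : measurable Q by exact: mD.
have kQ : key_invariant N (~` Q).
  move=> x y kxy; apply: contra_not; apply: deviates_key; exact: esym.
have mS := det_measurable (@symbol_det i).
have mQ' := measurableC mQ.
have H7 : (p 0 i - e) * pr (~` Q `&` B) <= pr (symbol_set i 0 `&` ~` Q `&` B).
  apply: (@class_le N).
  - exact: key_invariant_det.
  - apply: detI; last exact: key_invariant_det.
    by apply: detW (@symbol_det i).
  - by [].
  - exact: S_invariant_future.
  - move=> c; have [[x [Qx cx]]|none] := pselect ((~` Q `&` key_class N c) !=set0).
      rewrite -setIA; have -> : ~` Q `&` key_class N c = past_class N x.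
        rewrite /past_class cx; apply: setIidr => y yc; apply: kQ Qx.
        by rewrite cx yc.
      move: Qx; rewrite /Q /deviates /= => /negP; rewrite -leNgt pr_symbol ler_norml.
      by move=> /andP[H _]; rewrite mulrBl; lra.
    rewrite -setIA (_ : ~` Q `&` _ = set0) ?setI0 ?pr_set0 ?mulr0//.
    by apply/seteqP; split => x //= Hx; apply: none; exists x.
have H1 : pr B <= pr (~` Q `&` B) + e.
  have := prIC mu mB mQ'; rewrite setCK setIC => ->; rewrite lerD2l.
  apply: le_trans (ltW QN); apply: pr_le => //; first exact: measurableI.
have H2 : pr (symbol_set i 0 `&` ~` Q `&` B) <= pr (symbol_set i 0 `&` B).
  apply: pr_le; [by apply: measurableI => //; exact: measurableI|exact: measurableI|].
  by move=> x [[? _] ?].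
have H3 : pr (~` Q `&` B) <= 1 by apply: pr_le1; exact: measurableI.
have H4 := pr_ge0 mu (~` Q `&` B).
have H5 : p 0 i <= 1 by rewrite -pr_symbol; exact: pr_le1.
have H6 := p_gt0 i.
rewrite (_ : e0 = e + e); last by rewrite /e; lra.
nra.
Qed.

(** Both sides of the lower bounds of [symbol_indep_ge] sum to [pr B] over all symbols, so each
    bound is an equality. *)
Lemma symbol_indep B i : measurable B -> S_invariant B ->
  pr (symbol_set i 0 `&` B) = p 0 i * pr B.
Proof.
move=> mB iB; apply/eqP; rewrite eq_le symbol_indep_ge// andbT.
have := pr_sum_symbol mB; rewrite (bigD1 i)//= => H.
have : \sum_j p 0 j * pr B = pr B by rewrite -big_distrl /= pprob.2 mul1r.
rewrite (bigD1 i)//= => H'.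
have : \sum_(j | j != i) p 0 j * pr B <= \sum_(j | j != i) pr (symbol_set j 0 `&` B).
  by apply: ler_sum => j _; exact: symbol_indep_ge.
by lra.
Qed.

Definition cons_word (i k : 'I_n.+1) : nat -> 'I_n.+1 := fun t => if t is 0%N then i else k.

(* The sequences y with iy in B, closed under the tail permutation relation so
   that symbol_indep also applies to it. *)
Definition uncons i B : set X := S_saturation
  (\bigcup_(k in [set k | A i k = 1%N]) prefix_swap 1 (cons_word i k) 0 (fun=> k) B).

Lemma cons_word_admissible i k : A i k = 1%N ->
  forall t, (t < 1)%N -> A (cons_word i k t) (cons_word i k t.+1) = 1%N.
Proof. by move=> Aik [|]. Qed.

Lemma uncons_measurable i B : measurable B -> measurable (uncons i B).
Proof.
move=> mB; apply: S_saturation_measurable; apply: fin_bigcup_measurable.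
  exact: finite_finset.
by move=> k /cons_word_admissible adm; apply: (pr_prefix_swap adm _ _ mB).1.
Qed.

Lemma uncons_invariant i B : S_invariant (uncons i B).
Proof. by move=> x y; exact: S_saturation_invariant. Qed.

(** The saturation in [uncons] adds nothing here: equivalent sequences remain equivalent when the
    same symbol is put in front, and [B] is invariant. *)
Lemma prefix_swap_uncons B l v : S_invariant B -> A (v 0%N) (v 1%N) = 1%N ->
  prefix_swap 1 v 0 (fun=> v 1%N) (B `&` cyl l.+1 v) =
  uncons (v 0%N) B `&` cyl l (fun t => v t.+1).
Proof.
move=> iB Av; apply/seteqP; split => y.
  move=> [y0 [x [[Bx xv] xv1 xy]]]; split; last first.
    by move=> t tl; rewrite -[t]add0n -xy xv.
  exists y; last exact: S_rel_refl.
  exists (v 1%N) => //; split => //; exists x; split => //.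
  by case=> [|[|]]// _; rewrite xv.
move=> [[y' [k Aik [y'0 [x' [Bx' x'v x'y']]]] yy'] yv].
have y0 : v 1%N = y 0%N by rewrite yv.
have [|x [xv xy]] := @splice_exists 1 v 0 y _ y0; first by case.
split; first by case=> // _.
exists x; split => //; split; last first.
  case=> [|t] tl; first by rewrite xv.
  by have := xy t; rewrite add1n add0n => ->; rewrite yv.
apply: iB Bx'; apply: (@S_rel_cons x' x y' y).
- by rewrite x'v// xv.
- by move=> t; have := x'y' t; rewrite add1n add0n.
- by move=> t; have := xy t; rewrite add1n add0n.
- exact: S_rel_sym.
Qed.

Lemma pr_uncons_cyl B l v : measurable B -> S_invariant B -> A (v 0%N) (v 1%N) = 1%N ->
  pr (B `&` cyl l.+1 v) * p 0 (v 1%N) =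
  p 0 (v 0%N) * P (v 0%N) (v 1%N) * pr (uncons (v 0%N) B `&` cyl l (fun t => v t.+1)).
Proof.
move=> mB iB Av; have mBv : measurable (B `&` cyl l.+1 v).
  by apply: measurableI => //; exact: cyl_measurable.
have [||_] := @pr_prefix_swap 1 v 0 (fun=> v 1%N) (B `&` cyl l.+1 v) _ _ erefl mBv.
- by case.
- by [].
rewrite prefix_swap_uncons// /mass big_ord1 big_ord0 mulr1 mulrC => ->.
congr (pr _ * _); rewrite -setIA; congr (_ `&` _); apply/esym/setIidl => x xv k k1.
by apply: xv; exact: leq_trans k1 _.
Qed.

Lemma not_admissible_cyl l v : A (v 0%N) (v 1%N) <> 1%N -> cyl l.+1 v = set0.
Proof.
move=> Av; apply/seteqP; split => x // xv; apply: Av.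
by rewrite -!xv// shift_space_admissible.
Qed.

(** The set of points of [B] starting with [i] is split by the second symbol [k]. Independence for
    [uncons i B] turns each piece into p(i) P(i,k) [pr (uncons i B)], and the row of [P] sums to
    1. *)
Lemma pr_uncons B i : measurable B -> S_invariant B -> pr (uncons i B) = pr B.
Proof.
move=> mB iB; apply: (mulfI (lt0r_neq0 (p_gt0 i))).
rewrite -[RHS]symbol_indep//.
have ms k : measurable [set x : X | x 1%N = k].
  by apply: (@det_measurable _ _ _ _ 1) => x y xy /=; rewrite xy.
have mS := det_measurable (@symbol_det i).
rewrite [RHS](pr_fibers mu ms); last exact: measurableI.
rewrite -[LHS]mulr1 -(Pstoch.2 i) big_distrr /=; apply: eq_bigr => k _.
have -> : symbol_set i 0 `&` B `&` [set x : X | x 1%N = k] = B `&` cyl 1 (cons_word i k).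
  apply/seteqP; split => x; first by move=> [[xi Bx] xk]; split => // -[|[|]].
  by move=> [Bx xik]; split; [split => //; exact: xik|exact: xik].
have [Aik|Aik] := eqVneq (A i k) 1%N.
  apply: (mulIf (lt0r_neq0 (p_gt0 k))).
  rewrite (@pr_uncons_cyl B 0 (cons_word i k))//=.
  rewrite -(symbol_setE (fun t => cons_word i k t.+1)) setIC symbol_indep//.
  - by ring.
  - exact: uncons_measurable.
  - exact: uncons_invariant.
rewrite not_admissible_cyl ?setI0 ?pr_set0; last exact/eqP.
have -> : P i k = 0.
  apply/eqP; rewrite eq_le Pstoch.1 andbT leNgt; apply/negP => /PA/eqP.
  by rewrite (negPf Aik).
by rewrite mulr0.
Qed.

(** Induction on [l] for all invariant sets at once: the first symbol is removed from the cylinder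
    and from [B], and [uncons] keeps both invariance and measure. *)
Lemma cyl_indep l : forall B v, measurable B -> S_invariant B ->
  pr (B `&` cyl l v) = mass l v * pr B.
Proof.
elim: l => [|l IH] B v mB iB.
  by rewrite -symbol_setE setIC symbol_indep// /mass big_ord0 mulr1.
have [Av|Av] := pselect (A (v 0%N) (v 1%N) = 1%N); last first.
  by rewrite -pr_cyl not_admissible_cyl// setI0 pr_set0 mul0r.
apply: (mulIf (lt0r_neq0 (p_gt0 (v 1%N)))).
rewrite pr_uncons_cyl// IH.
- have -> : mass l.+1 v = p 0 (v 0%N) * P (v 0%N) (v 1%N) *
      \prod_(k < l) P (v k.+1) (v k.+2).
    by rewrite -add1n massD /mass big_ord1; under eq_bigr do rewrite add1n.
  by rewrite pr_uncons// /mass; ring.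
- exact: uncons_measurable.
- exact: uncons_invariant.
Qed.

Lemma symbol_limit_ergodic : ergodic_S mu.
Proof.
move=> B0 mB0; set B := S_saturation B0.
have mB : measurable B by exact: S_saturation_measurable.
have iB : S_invariant B by move=> x y; exact: S_saturation_invariant.
have H C : measurable C -> pr (B `&` C) = pr C * pr B.
  move: C; apply: borel_ind => [|m v|C mC HC|F mF tF HF].
  - by rewrite setI0 pr_set0 mul0r.
  - by rewrite cyl_indep// pr_cyl.
  - by have := prIC mu mB mC; rewrite HC prC// => E; rewrite mulrBl mul1r; lra.
  - rewrite setI_bigcupr.
    have tBF : trivIset setT (fun k => B `&` F k) by exact: trivIset_setIl.
    have mBF k : measurable (B `&` F k) by exact: measurableI.
    have c1 := @pr_bigcup_cvg _ _ _ mu _ mBF tBF.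
    have c2 : (fun N => (\sum_(0 <= k < N) pr (F k)) * pr B) @ \oo
        --> pr (\bigcup_k F k) * pr B.
      by apply: cvgM; [exact: pr_bigcup_cvg|exact: cvg_cst].
    apply/eqP; rewrite -(cvg_lim _ c2)// -(cvg_lim _ c1)//.
    apply/eqP; congr (lim (_ @ \oo)); apply/funext => N.
    by rewrite big_distrl; apply: eq_bigr => k _; exact: HF.
have := H B mB; rewrite setIid => HB.
have : pr B * (1 - pr B) = 0 by lra.
move=> /eqP; rewrite mulf_eq0 => /orP[/eqP B00|/eqP B1]; [left|right].
  by apply/negligibleP => //; apply: etrans (prE mu mB) _; rewrite B00.
apply/negligibleP; first exact: measurableC.
by apply: etrans (prE mu (measurableC mB)) _; rewrite prC// B1.
Qed.

End IndependenceOfSymbols.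

(** * Ratio limits without the last symbol *)

Local Notation step := (fun a b : 'I_n.+1 => A a b == 1%N).

Section SecondLimit.
Context (Serg : ergodic_S mu).

Lemma path_mkseq x m : path step (x 0%N) (mkseq (fun t => x t.+1) m) /\
  last (x 0%N) (mkseq (fun t => x t.+1) m) = x m.
Proof.
elim: m => [//|m [IHp IHl]]; rewrite mkseqS rcons_path last_rcons IHp IHl.
by rewrite shift_space_admissible.
Qed.

Lemma mkseq_cons x m : mkseq x m.+1 = x 0%N :: mkseq (fun t => x t.+1) m.
Proof.
rewrite /mkseq /=; congr cons; rewrite (iotaDl 1 0) -map_comp.
by apply: eq_map => t /=; rewrite add1n.
Qed.

Lemma irreducible_path i j : exists2 s, path step i s & last i s = j.
Proof.
have [m _ +] := Airr i j.
elim: m => [|m IH] in j *.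
  by rewrite expr0 mxE; case: eqP => [<- _|//]; exists [::].
rewrite exprSr mxE lt0n => Am.
have [k] : exists k, (0 < (A ^+ m) i k * A k j)%N.
  apply/not_existsP => An; move/eqP: Am; apply; apply: big1 => k _.
  by apply/eqP; rewrite eqn0Ngt; apply/negP; exact: An.
rewrite muln_gt0 => /andP[/IH [s ps ls] Akj]; exists (rcons s j).
  by rewrite rcons_path ps ls; have [A0|->] := A01 k j; rewrite ?A0 in Akj *.
by rewrite last_rcons.
Qed.

Lemma symbol_set_measurable i m : measurable (symbol_set i m : set X).
Proof. by apply: (@det_measurable _ _ _ _ m) => x y xy; rewrite /symbol_set /= xy. Qed.

(* By ergodicity the saturation of [i]_0 has full measure, hence meets [j]_0. *)
Lemma ergodic_merge i j : exists t t' k, [/\ path step i (rcons t k),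
  path step j (rcons t' k) & perm_eq (i :: t) (j :: t')].
Proof.
have mi := symbol_set_measurable i 0; have mj := symbol_set_measurable j 0.
have mS := S_saturation_measurable mi.
have [x [xj [y yi xy]]] : (symbol_set j 0 `&` S_saturation (symbol_set i 0 : set X)) !=set0.
  apply/set0P/eqP => E0.
  have := ergodic_zero_one Serg mS.
  case=> [x y xy|S0|S1].
  - exact: S_saturation_invariant.
  - have : pr (symbol_set i 0) <= pr (S_saturation (symbol_set i 0)).
      by apply: pr_le => // x xi; exists x => //; exact: S_rel_refl.
    by rewrite S0 pr_symbol leNgt p_gt0.
  - have : pr (symbol_set j 0) <= pr (~` S_saturation (symbol_set i 0 : set X)).
      apply: pr_le => //; first exact: measurableC.
      move=> x xj Sx.
      have : (symbol_set j 0 `&` S_saturation (symbol_set i 0 : set X)) x by [].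
      by rewrite E0.
    by rewrite prC// S1 subrr pr_symbol leNgt p_gt0.
move: xy => /S_relP[K [/keyP[pm _] tl]].
exists (mkseq (fun t => y t.+1) K), (mkseq (fun t => x t.+1) K), (y K.+1); split.
- by rewrite -(mkseqS (fun t => y t.+1)) -yi; have [] := path_mkseq y K.+1.
- by rewrite -(tl K.+1)// -(mkseqS (fun t => x t.+1)) -xj; have [] := path_mkseq x K.+1.
- by rewrite -{1}yi -{1}xj -!mkseq_cons perm_sym.
Qed.

(* Loops whose symbol counts differ by a unit vector: the counts of loops generate Z^n. *)
Lemma ergodic_loops b i : exists l l', [/\ path step b l, last b l = b,
  path step b l', last b l' = b & perm_eq l' (i :: l)].
Proof.
have [x xi] : (symbol_set i 0 : set X) !=set0.
  apply/set0P/eqP => E0; have := pr_symbol i; rewrite E0 pr_set0 => p0.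
  by have := p_gt0 i; rewrite -p0 ltxx.
have ix : step i (x 1%N) by rewrite -xi shift_space_admissible.
have [t [t' [k [pt pt' tt']]]] := ergodic_merge i (x 1%N).
have [q pq lq] := irreducible_path b i; have [r pr lr] := irreducible_path k b.
exists (q ++ rcons t k ++ r), (q ++ (x 1%N :: rcons t' k) ++ r); split.
- by rewrite !cat_path pq lq pt last_rcons pr.
- by rewrite !last_cat last_rcons.
- by rewrite !cat_path pq lq /= ix pt' last_rcons pr.
- by rewrite !last_cat /= last_rcons.
apply/permP => a; move/permP: tt' => /(_ a).
by rewrite /= !count_cat /= -!cats1 !count_cat /=; lia.
Qed.

(** The words of [ergodic_merge] have equal counts only when [i] and [j] are included. Loops at the
    common end [k] correct this: [l'] against [l] adds one [i] to the first word, and [r'] against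
    [r] adds one [j] to the second. *)
Lemma ergodic_perm_merge i j : exists s s', [/\ path step i s, path step j s',
  last i s = last j s' & perm_eq s s'].
Proof.
have [t [t' [k [pt pt' tt']]]] := ergodic_merge i j.
have [l [l' [pl ll pl' ll' pm]]] := ergodic_loops k i.
have [r [r' [pr lr pr' lr' pm']]] := ergodic_loops k j.
exists (rcons t k ++ l' ++ r), (rcons t' k ++ l ++ r'); split.
- by rewrite !cat_path pt last_rcons pl' ll' pr.
- by rewrite !cat_path pt' last_rcons pl ll pr'.
- by rewrite !last_cat !last_rcons ll' ll lr lr'.
apply/permP => a; move/permP: tt' => /(_ a); move/permP: pm => /(_ a).
move/permP: pm' => /(_ a); rewrite /= !count_cat -!cats1 !count_cat /=; lia.
Qed.

(** Pigeonhole on the residues modulo [D]. It serves to space the events so widely that words read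
    at different times do not overlap. *)
Lemma infinitely_often_subseq (Q : nat -> set X) D : (0 < D)%N ->
  infinitely_often Q `<=` \bigcup_r infinitely_often (fun t => Q (r + D * t)%N).
Proof.
move=> D0 x Qx; apply: contrapT => nQ.
have /choice[N HN] r : exists N, forall t, (N <= t)%N -> ~ Q (r + D * t)%N x.
  apply: contrapT => H; apply: nQ; exists r => // N.
  apply: contrapT => H'; apply: H; exists N => t Nt Qt; apply: H'; by exists t.
have [m Hm Qm] := Qx (\max_(r < D) (r + D * N r))%N.
have mD : (m %% D < D)%N by rewrite ltn_mod.
apply: (HN (m %% D)%N (m %/ D)%N); last by rewrite addnC mulnC -divn_eq.
have := leq_trans (leq_bigmax (F := fun r : 'I_D => (r + D * N r)%N) (Ordinal mD)) Hm.
rewrite /= => H; rewrite -(leq_pmul2l D0) -(leq_add2l (m %% D)).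
by apply: leq_trans H _; rewrite {1}(divn_eq m D) addnC mulnC.
Qed.

Lemma infinitely_often_null_finite (I : finType) (Q : I -> nat -> set X) (Q0 : nat -> set X) :
  (forall i m, measurable (Q i m)) -> (forall m, measurable (Q0 m)) ->
  (forall m x, Q0 m x -> exists i, Q i m x) ->
  (forall i, pr (infinitely_often (Q i)) = 0) -> pr (infinitely_often Q0) = 0.
Proof.
move=> mQ mQ0 QQ HQ.
have mU (s : seq I) m : measurable (\bigcup_(i in [set` s]) Q i m).
  by apply: fin_bigcup_measurable => //; exact: finite_finset.
suff H (s : seq I) : pr (infinitely_often (fun m => \bigcup_(i in [set` s]) Q i m)) = 0.
  apply: (@infinitely_often_nullU Q0 _ _ mQ0 (mU (enum I)) (mU (enum I))) => //.
  by move=> m x /QQ[i Qi]; left; exists i => //=; rewrite mem_enum.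
elim: s => [|i s IH].
  rewrite (_ : infinitely_often _ = set0) ?pr_set0//.
  by apply/seteqP; split => x // /(_ 0%N)[m _ []].
apply: (infinitely_often_nullU (mU _) (mQ i) (mU s)) => // m x [k /=].
by rewrite inE => /orP[/eqP->|ks] Qk; [left|right; exists k].
Qed.

Section FixedEvent.
Context (B : set X) (mB : measurable B) (e d : R) (e0 : 0 < e) (d0 : 0 < d).

Definition count_class m x (j : 'I_n.+1) : set X := count_set (psi0 m.+1 x) m `&` symbol_set j m.

(** A condition on the counts of [x] alone: the symbol of [x] at time [m] need not be [j]. When it
    is, [x] is a point of deviation. *)
Definition bad_counts (j : 'I_n.+1) m : set X := [set x : X |
  d * pr (count_set (psi0 m.+1 x) m) <= pr (count_class m x j) /\
  e * pr (count_class m x j) <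
    `|pr (B `&` count_class m x j) - pr B * pr (count_class m x j)|].

Lemma bad_counts_psi0 j m x y : psi0 m.+1 x = psi0 m.+1 y -> bad_counts j m x -> bad_counts j m y.
Proof. by rewrite /bad_counts /count_class /= => ->. Qed.

Lemma bad_counts_det j m : det m (bad_counts j m).
Proof. by move=> x y xy; apply: bad_counts_psi0; have /key_psi0[] := key_eq xy. Qed.

Lemma bad_counts_deviates j m x : bad_counts j m x -> x m = j -> deviates B e m x.
Proof. by move=> [_ +] xj; rewrite /count_class -xj past_classE. Qed.

Definition follows m L (v : nat -> 'I_n.+1) : set X :=
  [set x : X | forall k, (k <= L)%N -> x (m + k)%N = v k].

Lemma follows_det m L v : det (m + L) (follows m L v).
Proof. by move=> x y xy H k kL; rewrite -xy ?H// leq_add2l. Qed.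

Lemma count_set_det c m : det m (count_set c m : set X).
Proof.
move=> x y xy; rewrite /count_set /=; have /key_psi0[-> _] := key_eq xy; exact.
Qed.

Lemma symbol_set_det i m : det m (symbol_set i m : set X).
Proof. by move=> x y xy; rewrite /symbol_set /= xy. Qed.

Section TwoWords.
Context (i j : 'I_n.+1) (s s' : seq 'I_n.+1).
Context (path_i : path step i s) (path_j : path step j s')
  (ls : last i s = last j s') (ss' : perm_eq s s').
Let L := size s.
Let vi := nth i (i :: s).
Let vj := nth j (j :: s').

(** After bad counts the point continues by the word of [i] or by that of [j]. Both lead to the same
    counts and the same last symbol, so the key at time [m + L] does not reveal which one was
    taken. *)
Definition one_of_two_words m : set X :=
  bad_counts j m `&` (follows m L vi `|` follows m L vj).

Lemma one_of_two_words_det m : det (m + L) (one_of_two_words m).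
Proof.
move=> x y xy [bx fx]; split; first by apply: (bad_counts_det _ bx) => k km; apply: xy; lia.
by case: fx => [fx|fx]; [left|right]; apply: follows_det fx.
Qed.

Lemma size_words : size s' = L.
Proof. by rewrite /L (perm_size ss'). Qed.

Lemma mkseq_follows m (l : seq 'I_n.+1) h x : size l = L -> follows m L (nth h (h :: l)) x ->
  mkseq x (m + L).+1 = mkseq x m.+1 ++ l.
Proof.
move=> sl H; rewrite -addSn /mkseq iotaD map_cat; congr (_ ++ _).
apply: (@eq_from_nth _ h) => [|k]; first by rewrite size_map size_iota sl.
rewrite size_map size_iota => kL; rewrite (nth_map 0%N) ?size_iota// nth_iota//.
by rewrite add0n addSnnS H.
Qed.

Lemma two_words_end : vi L = vj L.
Proof.
have -> : vj L = last j s'.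
  by rewrite -size_words /vj -[size s']/((size (j :: s')).-1) nth_last.
by rewrite -ls /vi /L -[size s]/((size (i :: s)).-1) nth_last.
Qed.

Lemma two_words_key m x y : (follows m L vi `|` follows m L vj) x ->
  (follows m L vi `|` follows m L vj) y ->
  key (m + L) x = key (m + L) y <-> psi0 m.+1 x = psi0 m.+1 y.
Proof.
have E z : (follows m L vi `|` follows m L vj) z ->
    perm_eq (mkseq z (m + L).+1) (mkseq z m.+1 ++ s) /\ z (m + L)%N = vi L.
  move=> [H|H]; split; rewrite ?(H _ (leqnn _)) ?two_words_end//.
    by rewrite (mkseq_follows _ H).
  by rewrite (mkseq_follows _ H) ?size_words// perm_cat2l perm_sym.
move=> /E[px xL] /E[py yL]; rewrite keyP psi0_perm xL yL.
split=> [[pm _]|pm].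
  by rewrite -(perm_cat2r s) -(permPl px) -(permPr py).
by split=> //; rewrite (permPl px) (permPr py) perm_cat2r.
Qed.

Definition word_prob (v : nat -> 'I_n.+1) : R := \prod_(k < L) P (v k) (v k.+1).

Lemma word_prob_gt0 (l : seq 'I_n.+1) h : size l = L -> path step h l ->
  0 < word_prob (nth h (h :: l)).
Proof.
move=> sl /(pathP h) H; apply: prodr_gt0 => k _; apply/PA/eqP.
by apply: H; rewrite sl.
Qed.

(** Within a key class at time [m + L], the word of [j] carries at least the proportion
    [d * word_prob vj], and taking it makes [m] a time of deviation. Times advance by [L.+1], so a
    later occurrence starts after the current word ends and is a future event. *)
Lemma one_of_two_words_cover r :
  d * word_prob vj * pr (\bigcup_t one_of_two_words (r + L.+1 * t)) <=
  pr (\bigcup_(m in [set m | (r <= m)%N]) deviates B e m).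
Proof.
have rj : 0 < word_prob vj by apply: word_prob_gt0; rewrite ?size_words.
have mW m : measurable (one_of_two_words m) := det_measurable (@one_of_two_words_det m).
have mU : measurable (\bigcup_(m in [set m | (r <= m)%N]) deviates B e m).
  by apply: bigcup_measurable => m _; exact: deviates_measurable.
apply: last_index_cover; [by rewrite ltW// mulr_gt0|exact: mU|by move=> t; exact: mW|].
move=> t M V VE; set m := (r + L.+1 * t)%N in VE.
pose G := \bigcup_(k in [set k | (t < k < M)%N]) one_of_two_words (r + L.+1 * k).
rewrite -[\bigcup_(k in _) _]/G setDE in VE.
have mG : measurable G by apply: bigcup_measurable => k _; exact: mW.
have fG : future_event (m + L) (~` G).
  move=> x y kxy tl; apply: contra_not => -[k /= tk [by_ fy]]; exists k => //.
  have mk : (m + L <= r + L.+1 * k)%N.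
    have : (L.+1 * t.+1 <= L.+1 * k)%N by rewrite leq_mul2l; lia.
    by rewrite /m mulnS; lia.
  split.
    apply: bad_counts_psi0 by_.
    by have /key_psi0[] := key_trans mk kxy tl.
  by case: fy => [fy|fy]; [left|right] => l lL; rewrite tl ?fy//; lia.
pose C2 := one_of_two_words m `&` symbol_set j m.
have dj : det (m + L) (symbol_set j m : set X).
  by apply: detW (@symbol_set_det j m); rewrite leq_addr.
have mC2 : measurable C2 by apply: measurableI => //; exact: det_measurable dj.
apply: (@le_trans _ _ (pr (C2 `&` ~` G))).
  rewrite VE; apply: (@class_le (m + L)) => //.
  - exact: one_of_two_words_det.
  - by apply: detI => //; exact: one_of_two_words_det.
  - exact: measurableC.
  move=> c; have [[x [Wx cx]]|none] :=
      pselect ((one_of_two_words m `&` key_class (m + L) c) !=set0); last first.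
    rewrite (_ : one_of_two_words m `&` _ = set0) ?pr_set0 ?mulr0 ?pr_ge0//.
    by apply/seteqP; split => x //= Hx; apply: none; exists x.
  have mE : measurable (key_class (m + L) c).
    by apply: det_measurable; exact: key_class_det.
  have mct := det_measurable (@count_set_det (psi0 m.+1 x) m).
  have dcl : det m (count_class m x j).
    by apply: detI; [exact: count_set_det|exact: symbol_set_det].
  (* In this class the two words force the counts of [x] at time [m]; conversely [H2] continues the
     points with these counts and last symbol [j] by the word of [j]. *)
  have H1 : pr (one_of_two_words m `&` key_class (m + L) c) <= pr (count_set (psi0 m.+1 x) m).
    apply: pr_le => //; first exact: measurableI.
    by move=> y [Wy cy]; apply/(two_words_key Wy.2 Wx.2); rewrite cx cy.
  have H2 : pr (count_class m x j `&` follows m L vj) <= pr (C2 `&` key_class (m + L) c).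
    apply: pr_le; [|exact: measurableI|].
      apply: measurableI; first exact: det_measurable dcl.
      exact: det_measurable (@follows_det m L vj).
    move=> y [[py yj] fy]; split; last first.
      by rewrite /key_class /= -cx; apply/(@two_words_key m y x) => //; [right|exact: Wx.2].
    split => //; split; last by right.
    by apply: bad_counts_psi0 Wx.1; rewrite py.
  have H3 : pr (count_class m x j `&` follows m L vj) = pr (count_class m x j) * word_prob vj.
    by apply: pr_follow => // y [].
  have H4 := Wx.1.1.
  rewrite H3 in H2; apply: le_trans H2.
  apply: (@le_trans _ _ (d * word_prob vj * pr (count_set (psi0 m.+1 x) m))).
    by apply: ler_wpM2l => //; rewrite ltW// mulr_gt0.
  by rewrite mulrAC; apply: ler_wpM2r => //; exact: ltW.
apply: pr_le.
- by apply: measurableI => //; exact: measurableC.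
- by rewrite VE; do 2?[apply: measurableI => //]; exact: measurableC.
move=> x [[Wx xj] Gx]; rewrite VE; split => //; exists m; first by rewrite /= leq_addr.
by apply: (bad_counts_deviates Wx.1).
Qed.

Lemma one_of_two_words_null : pr (infinitely_often one_of_two_words) = 0.
Proof.
have rj : 0 < d * word_prob vj.
  by rewrite mulr_gt0//; apply: word_prob_gt0; rewrite ?size_words.
have mW m : measurable (one_of_two_words m) := det_measurable (@one_of_two_words_det m).
have mD m : measurable (deviates B e m) by exact: deviates_measurable.
suff H r : pr (infinitely_often (fun t => one_of_two_words (r + L.+1 * t))) = 0.
  have mI r : measurable (infinitely_often (fun t => one_of_two_words (r + L.+1 * t))).
    by apply: infinitely_often_measurable => t; exact: mW.
  suff N0 : mu (infinitely_often one_of_two_words) = 0%E by rewrite /pr N0.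
  apply: measure_negligible; first exact: infinitely_often_measurable.
  apply: negligibleS (@infinitely_often_subseq one_of_two_words L.+1 isT) _.
  apply: negligible_bigcup => r; apply/negligibleP => //.
  by apply: etrans (prE mu (mI r)) _; rewrite H.
apply/eqP; rewrite eq_le pr_ge0 andbT; apply/ler_addgt0Pr => f f0; rewrite add0r.
have [N HN] := tail_union_small mD (deviates_null Serg mB e0) (mulr_gt0 rj f0).
rewrite -(ler_pM2l rj); apply: le_trans (ltW HN).
apply: (@le_trans _ _ (pr (\bigcup_(m in [set m | (r + L.+1 * N <= m)%N]) deviates B e m))).
  apply: le_trans (one_of_two_words_cover _); apply: ler_wpM2l; first exact: ltW.
  apply: pr_le.
  - by apply: infinitely_often_measurable => t; exact: mW.
  - by apply: bigcupT_measurable => t; exact: mW.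
  move=> x /(_ N)[t Nt Wt]; exists (t - N)%N => //.
  by rewrite -addnA -mulnDr subnKC.
apply: pr_le; [by exact: bigcup_measurable|by exact: bigcup_measurable|].
by move=> x [m /= rm Dm]; exists m => //=; lia.
Qed.

(** From the first occurrence after [N] the word of [i] follows with probability [word_prob vi],
    which is positive and independent of [N]; the resulting event lies in the tail unions of
    [one_of_two_words], which become small. *)
Lemma bad_counts_symbol_null :
  pr (infinitely_often (fun m => bad_counts j m `&` symbol_set i m)) = 0.
Proof.
have ri : 0 < word_prob vi by exact: word_prob_gt0.
have mW m : measurable (one_of_two_words m) := det_measurable (@one_of_two_words_det m).
have dD m : det m (bad_counts j m `&` symbol_set i m).
  by apply: detI; [exact: bad_counts_det|exact: symbol_set_det].
have mD m := det_measurable (dD m).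
apply/eqP; rewrite eq_le pr_ge0 andbT; apply/ler_addgt0Pr => f f0; rewrite add0r.
have [N HN] := tail_union_small mW one_of_two_words_null (mulr_gt0 ri f0).
rewrite -(ler_pM2l ri); apply: le_trans (ltW HN).
apply: (@le_trans _ _ (word_prob vi *
    pr (\bigcup_k (bad_counts j (N + k) `&` symbol_set i (N + k))))).
  apply: ler_wpM2l; first exact: ltW.
  apply: pr_le.
  - exact: infinitely_often_measurable.
  - by apply: bigcupT_measurable => k; exact: mD.
  by move=> x /(_ N)[m Nm Dm]; exists (m - N)%N => //; rewrite subnKC.
apply: first_index_cover; [exact: ltW|exact: bigcup_measurable|by move=> k; exact: mD|].
move=> k V VE.
have dV : det (N + k) V.
  rewrite VE setDE; apply: detI; first exact: dD.
  apply: detC; apply: det_bigcupP => l /= lk; apply: detW (dD _); lia.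
have mV := det_measurable dV.
have Vi : V `<=` [set x : X | x (N + k)%N = vi 0%N] by rewrite VE => x [[_ ?] _].
rewrite mulrC -(pr_follow L dV Vi); apply: pr_le.
- by apply: measurableI => //; exact: det_measurable (@follows_det (N + k) L vi).
- by apply: measurableI => //; exact: bigcup_measurable.
move=> x [Vx fx]; split => //; exists (N + k)%N; first by rewrite /= leq_addr.
by split; [move: Vx; rewrite VE => -[[]]|left].
Qed.

End TwoWords.

Lemma bad_counts_null j : pr (infinitely_often (bad_counts j)) = 0.
Proof.
apply: (@infinitely_often_null_finite 'I_n.+1 (fun i m => bad_counts j m `&` symbol_set i m)).
- move=> i m; apply: measurableI; first exact: det_measurable (@bad_counts_det j m).
  exact: symbol_set_measurable.
- by move=> m; exact: det_measurable (@bad_counts_det j m).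
- by move=> m x bx; exists (x m).
move=> i; have [s [s' [pi pj ls ss']]] := ergodic_perm_merge i j.
exact: bad_counts_symbol_null pi pj ls ss'.
Qed.

End FixedEvent.

Definition count_deviates B (e : R) m : set X :=
  [set x : X | e * pr (count_set (psi0 m.+1 x) m) <
    `|pr (B `&` count_set (psi0 m.+1 x) m) - pr B * pr (count_set (psi0 m.+1 x) m)|].

Lemma count_deviates_det B e m : det m (count_deviates B e m).
Proof.
move=> x y xy; rewrite /count_deviates /=; have /key_psi0[-> _] := key_eq xy; exact.
Qed.

Lemma count_deviates_null B e : measurable B -> 0 < e ->
  pr (infinitely_often (count_deviates B e)) = 0.
Proof.
(* Last symbols of conditional probability below [d] contribute at most (n + 1) d = e / 2 together;
   each of the others deviates by at most the fraction e / 2 of its class. *)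
move=> mB e0; pose d := e / 2 / n.+1%:R; have d0 : 0 < d by rewrite !divr_gt0.
have e2 : 0 < e / 2 by rewrite divr_gt0.
apply: (@infinitely_often_null_finite 'I_n.+1 (bad_counts B (e / 2) d)).
- by move=> j m; exact: det_measurable (@bad_counts_det _ _ _ j m).
- by move=> m; exact: det_measurable (@count_deviates_det B e m).
- move=> m x; apply: contraPP => /forallNP nb /=; apply/negP; rewrite -leNgt.
  set Cx := count_set (psi0 m.+1 x) m.
  have mC : measurable Cx by exact: det_measurable (@count_set_det _ m).
  have ms j : measurable [set y : X | y m = j] by exact: symbol_set_measurable.
  have mBC := measurableI _ _ mB mC.
  rewrite (pr_fibers mu ms mBC) (pr_fibers mu ms mC) !big_distrr /= -sumrB.
  apply: le_trans (ler_norm_sum _ _ _) _.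
  have -> : \sum_(j < n.+1) e * pr (Cx `&` [set y : X | y m = j]) =
      \sum_(j < n.+1) (d * pr Cx + e / 2 * pr (Cx `&` [set y : X | y m = j])).
    rewrite big_split /= sumr_const card_ord -!big_distrr /= -(pr_fibers mu ms mC).
    have : n.+1%:R != 0 :> R by rewrite pnatr_eq0.
    rewrite -mulr_natl /d; set z := n.+1%:R => z0; field.
    by [].
  apply: ler_sum => j _; have := nb j; rewrite /bad_counts /count_class /= -/Cx.
  rewrite -setIA -/(symbol_set j m).
  set r := pr (Cx `&` symbol_set j m); set b := pr (B `&` (Cx `&` symbol_set j m)).
  have r0 : 0 <= r by exact: pr_ge0.
  have c0 : 0 <= pr Cx by exact: pr_ge0.
  have b0 : 0 <= b by exact: pr_ge0.
  have p0 := pr_ge0 mu B; have p1 := pr_le1 mu mB.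
  have br : b <= r.
    have mCs := measurableI _ _ mC (symbol_set_measurable j m).
    by apply: pr_le => //; exact: measurableI.
  have [dr|dr] := leP (d * pr Cx) r.
    move=> H; have : `|b - pr B * r| <= e / 2 * r by rewrite leNgt; apply/negP => ?; apply: H.
    by move=> H'; apply: le_trans H' _; rewrite lerDr mulr_ge0// ltW.
  move=> _; have : `|b - pr B * r| <= r by rewrite ler_norml; apply/andP; split; nra.
  move=> H; apply: le_trans H _; have := mulr_ge0 (ltW e2) r0; lra.
- by move=> j; exact: bad_counts_null.
Qed.

End SecondLimit.

(** * The adic transformation *)

Lemma adic_rel x : S_rel x (adic x).
Proof.
rewrite /adic; case: asboolP => _; first exact: S_rel_refl.
by case: xgetP => [y -> [Sxy _ _]|_]; [exact: Sxy|exact: S_rel_refl].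
Qed.

Lemma ergodic_map_ergodic_S : ergodic_map mu (@adic n A A01 Airr) -> ergodic_S mu.
Proof.
move=> erg B mB; have mS := S_saturation_measurable mB.
have [|S0|S0] := erg _ mS; [|by left; apply/negligibleP|right].
  apply/seteqP; split => x /=; apply: S_saturation_invariant.
    exact: S_rel_sym (adic_rel x).
  exact: adic_rel.
by apply/negligibleP => //; exact: measurableC.
Qed.

Lemma class_has_max_rel x y : S_rel x y -> class_has_max y -> class_has_max x.
Proof.
move=> xy [z [yz zmax]]; exists z; split; first exact: S_rel_trans yz.
by move=> u xu; apply: zmax; apply: S_rel_trans xu; exact: S_rel_sym.
Qed.

Lemma class_has_min_rel x y : S_rel x y -> class_has_min y -> class_has_min x.
Proof.
move=> xy [z [yz zmin]]; exists z; split; first exact: S_rel_trans yz.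
by move=> u xu; apply: zmin; apply: S_rel_trans xu; exact: S_rel_sym.
Qed.

(** Descent on the rank of [y]: if [y] is not the successor, a point strictly between has smaller
    rank and the same tail. *)
Lemma immediate_successor_exists K N0 x y : (rank K y <= N0)%N -> S_rel x y -> prec x y ->
  (forall k, (K <= k)%N -> x k = y k) ->
  exists z, immediate_successor x z /\ (z = y \/ prec z y).
Proof.
elim: N0 y => [|N0 IH] y yN Sxy xy tl.
  by have := leq_trans (rank_lt xy tl) yN; rewrite ltn0.
have [H|] := pselect (forall z, S_rel x z -> ~ (prec x z /\ prec z y)).
  by exists y; split; [split|left].
move=> /existsNP[z /not_implyP[Sxz /contrapT[xz zy]]].
have xz_tl := prec_between xz zy tl.
have zy_tl k : (K <= k)%N -> z k = y k by move=> Kk; rewrite -xz_tl ?tl.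
have [|u [su uz]] := IH z _ Sxz xz xz_tl.
  by rewrite -ltnS; apply: leq_trans yN; exact: rank_lt.
exists u; split => //; right; case: uz => [->//|uz]; exact: prec_trans uz zy.
Qed.

Lemma immediate_successor_uniq x y z :
  immediate_successor x y -> immediate_successor x z -> y = z.
Proof.
move=> [Sxy xy ymin] [Sxz xz zmin].
have : S_rel y z by apply: S_rel_trans Sxz; exact: S_rel_sym.
move=> [K [tl _]]; have [yz|[yz|zy]] := prec_total tl.
- exact: shift_space_ext.
- by case: (zmin y Sxy).
- by case: (ymin z Sxz).
Qed.

Lemma adic_successor x y : ~ class_has_max x -> ~ class_has_min x ->
  S_rel x y -> prec x y -> immediate_successor x (adic x) /\ (adic x = y \/ prec (adic x) y).
Proof.
move=> nmax nmin Sxy xy; have [K [tl _]] := Sxy.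
have [z [sz zy]] := immediate_successor_exists (leqnn (rank K y)) Sxy xy tl.
suff -> : adic x = z by [].
rewrite /adic; case: asboolP => [[]//|_].
by case: xgetP => [u -> su|/(_ z)//]; exact: immediate_successor_uniq su sz.
Qed.

Lemma adic_invariant_class B x y : (@adic n A A01 Airr) @^-1` B = B ->
  ~ class_has_max x -> ~ class_has_min x -> S_rel x y -> B x <-> B y.
Proof.
move=> adicB; have adB u : B (adic u) <-> B u by rewrite -[in X in _ <-> X]adicB.
(* Each application of [adic] to [u] stays at or below [v] and raises the rank, so [v] is reached
   after finitely many steps. *)
have up K d : forall u v : X, (rank K v - rank K u <= d)%N -> ~ class_has_max u ->
    ~ class_has_min u -> (forall k, (K <= k)%N -> u k = v k) -> S_rel u v ->
    prec u v -> B u <-> B v.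
  elim: d => [|d IH] u v uvd nmax nmin tl Suv uv.
    by have := rank_lt uv tl; rewrite ltnNge -subn_eq0 -leqn0 uvd.
  have [[Su pu _] [<-|av]] := adic_successor nmax nmin Suv uv; first by rewrite adB.
  have tla := prec_between pu av tl.
  have r1 := rank_lt pu tla.
  rewrite -adB; apply: IH => //.
  - by rewrite leq_subLR; move: uvd; rewrite leq_subLR; lia.
  - by apply: contra_not nmax; exact: class_has_max_rel.
  - by apply: contra_not nmin; exact: class_has_min_rel.
  - by move=> k Kk; rewrite -tla ?tl.
  - by apply: S_rel_trans Suv; exact: S_rel_sym.
move=> nmax nmin Sxy; have [K [tl _]] := Sxy.
have [xy|[xy|yx]] := prec_total tl.
- by rewrite (shift_space_ext xy).
- exact: (up K _ x y (leqnn _)).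
- apply: iff_sym; apply: (up K _ y x (leqnn _)) => //.
  + by apply: contra_not nmax; exact: class_has_max_rel.
  + by apply: contra_not nmin; exact: class_has_min_rel.
  + by move=> k Kk; rewrite tl.
  + exact: S_rel_sym.
Qed.

(** Replacing an occurrence of [s] in [y] by [s'] keeps the point admissible and in its class, and
    moves it up or down according to the order of the two words. *)
Lemma swap_words m b (s s' : seq 'I_n.+1) y : path step b s -> path step b s' ->
  last b s = last b s' -> perm_eq s s' -> follows m (size s) (nth b (b :: s)) y ->
  exists z, [/\ S_rel y z, prec (nth b (b :: s)) (nth b (b :: s')) -> prec y z &
    prec (nth b (b :: s')) (nth b (b :: s)) -> prec z y].
Proof.
move=> ps ps' ls ss' fy; set L := size s in fy *.
have sz : size s' = L by rewrite /L (perm_size ss').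
set v := nth b (b :: s) in fy *; set v' := nth b (b :: s').
have vL : v L = v' L.
  have -> : v' L = last b s' by rewrite -sz /v' -[size s']/((size (b :: s')).-1) nth_last.
  by rewrite -ls /v /L -[size s]/((size (b :: s)).-1) nth_last.
have vout k : (L < k)%N -> v k = v' k.
  by move=> Lk; rewrite /v /v' !nth_default//= ?sz.
pose w k := if (k < m)%N then y k else if (k <= m + L)%N then v' (k - m)%N else y k.
have wl k : (k <= m)%N -> w k = y k.
  rewrite leq_eqVlt => /orP[/eqP->|km]; last by rewrite /w km.
  by rewrite /w ltnn leq_addr subnn -[m in RHS]addn0 fy.
have wm k : (k <= L)%N -> w (m + k)%N = v' k.
  by move=> kL; rewrite /w ltnNge leq_addr /= leq_add2l kL addKn.
have wr k : (m + L <= k)%N -> w k = y k.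
  rewrite leq_eqVlt => /orP[/eqP<-|mk]; first by rewrite wm// -vL fy.
  by rewrite /w ltnNge (leq_trans (leq_addr L m) (ltnW mk)) /= leqNgt mk.
have [k|z zE] := @shift_space_exists n A A01 Airr w.
  have [km|mk] := ltnP k m; first by rewrite !wl ?shift_space_admissible// ltnW.
  have [kmL|mLk] := ltnP k (m + L); last by rewrite !wr ?shift_space_admissible// leqW.
  rewrite -(subnKC mk) -addnS !wm; [|lia|lia].
  by apply/eqP; move/(pathP b): ps'; apply; rewrite sz; lia.
have fz : follows m L v' z by move=> k kL; rewrite zE wm.
exists z; split.
- apply/S_relP; exists (m + L)%N; split; last by move=> k mk; rewrite zE wr.
  apply/keyP; split; last by rewrite zE wr.
  rewrite (mkseq_follows (s := s) erefl fy) (mkseq_follows (s := s) sz fz).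
  have -> : mkseq z m.+1 = mkseq y m.+1.
    by apply/eq_in_map => k; rewrite mem_iota => /andP[_ km]; rewrite zE wl.
  by rewrite perm_cat2l.
- move=> [d [vd tl]]; have dL : (d <= L)%N.
    by rewrite leqNgt; apply/negP => /vout E; rewrite E ltnn in vd.
  exists (m + d)%N; rewrite fy// fz//; split => // k mdk.
  have [kL|kL] := leqP k (m + L); last by rewrite zE wr// ltnW.
  have mk : (m <= k)%N by lia.
  by rewrite -(subnKC mk) fy ?fz ?tl//; lia.
- move=> [d [vd tl]]; have dL : (d <= L)%N.
    by rewrite leqNgt; apply/negP => /vout E; rewrite E ltnn in vd.
  exists (m + d)%N; rewrite fy// fz//; split => // k mdk.
  have [kL|kL] := leqP k (m + L); last by rewrite zE wr// ltnW.
  have mk : (m <= k)%N by lia.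
  by rewrite -(subnKC mk) fy ?fz ?tl//; lia.
Qed.

Section ErgodicAdic.
Context (Serg : ergodic_S mu).

(** By stationarity the word occurs at each time with the same positive probability, so its
    recurrence has positive probability. Recurrence depends on the tail only, hence it is invariant
    and almost sure. *)
Lemma follows_infinitely_often L v : (forall k, (k < L)%N -> A (v k) (v k.+1) = 1%N) ->
  mu.-negligible (~` infinitely_often (fun m => follows m L v)).
Proof.
move=> Av; have mF m : measurable (follows m L v).
  exact: det_measurable (@follows_det m L v).
have mI := infinitely_often_measurable mF.
have prF m : pr (follows m L v) = mass L v.
  rewrite /pr.
  rewrite (_ : follows m L v = [set x : X | forall k, (k <= L)%N -> x (m + k)%N = v k])//.
  by rewrite muP.
have : 0 < pr (infinitely_often (fun m => follows m L v)).
  apply: lt_le_trans (mass_gt0 Av) _; apply: pr_infinitely_often_ge => // N.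
  rewrite -(prF N); apply: pr_le => //; first exact: bigcup_measurable.
  by move=> x fx; exists N => //=.
have [|->|I1 _] := ergodic_zero_one Serg mI; last 1 first.
- apply/negligibleP; first exact: measurableC.
  by apply: etrans (prE mu (measurableC mI)) _; rewrite prC// I1 subrr.
- move=> x y [K [tl _]] Hx N; have [m] := Hx (maxn N K).
  rewrite geq_max => /andP[Nm Km] fx; exists m => // k kL.
  by rewrite -tl ?fx//; lia.
- by rewrite ltxx.
Qed.

(** Without branching, the shorter of two loops at [b] whose lengths differ by one is the beginning
    of the longer, so [b] follows itself. Every path is then constant, and irreducibility leaves a
    single symbol. *)
Lemma deterministic_constant :
  (forall b j k, A b j = 1%N -> A b k = 1%N -> j = k) -> forall i j : 'I_n.+1, i = j.
Proof.
move=> detA.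
have loop b : A b b = 1%N.
  have [l [l' [pl ll pl' ll' pm]]] := ergodic_loops Serg b b.
  case/lastP: l' => [|s c] in pl' ll' pm *; first by have := perm_size pm.
  have sl : size s = size l.
    by have := perm_size pm; rewrite size_rcons /= => -[].
  move: pl' ll'; rewrite rcons_path last_rcons => /andP[ps /eqP sc] cb.
  suff E : s = l by rewrite E ll cb in sc.
  elim: s l b {ll sc cb pm} pl ps sl => [|a s IH] [|a' l] b //= /andP[/eqP ba' pl].
  move=> /andP[/eqP ba ps] [sl]; have aa' := detA _ _ _ ba ba'.
  by rewrite aa' (IH l a')// -aa'.
move=> i j; have [s ps <-] := irreducible_path i j.
elim: s i ps => [//|a s IH] i /= /andP[/eqP ia ps].
by rewrite -(IH a ps); exact: detA (loop i) ia.
Qed.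

(* Two loops starting with different symbols, concatenated in both orders, give
   exchangeable words, whose recurrence rules out maximal and minimal elements. *)
Lemma exchangeable_words b j k : A b j = 1%N -> A b k = 1%N -> j <> k ->
  exists s s', [/\ path step b s, path step b s', last b s = last b s', perm_eq s s' &
    prec (nth b (b :: s)) (nth b (b :: s'))].
Proof.
move=> bj bk jk; have [q pq lq] := irreducible_path j b.
have [r pr_ lr] := irreducible_path k b.
pose l := j :: q; pose l' := k :: r.
have pl : path step b (l ++ l') by rewrite cat_path /= bj pq lq bk pr_.
have pl' : path step b (l' ++ l) by rewrite cat_path /= bk pr_ lr bj pq.
have ll : last b (l ++ l') = last b (l' ++ l) by rewrite !last_cat /= lq lr.
have pm : perm_eq (l ++ l') (l' ++ l) by rewrite perm_catC.
have agree i : ((size (l ++ l')).+1 <= i)%N ->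
    nth b (b :: l ++ l') i = nth b (b :: l' ++ l) i.
  move=> Hi; have Hi' : (size (b :: l' ++ l) <= i)%N by move: (Hi); rewrite (perm_size pm).
  by rewrite (nth_default b Hi') (@nth_default _ b (b :: l ++ l') i Hi).
have [h|[h|h]] := prec_total agree.
- by have := h 1%N.
- by exists (l ++ l'), (l' ++ l).
- by exists (l' ++ l), (l ++ l'); split => //; rewrite perm_sym.
Qed.

Lemma ergodic_S_ergodic_map : ergodic_map mu (@adic n A A01 Airr).
Proof.
move=> B mB adicB.
have [detA|] := pselect (forall b j k, A b j = 1%N -> A b k = 1%N -> j = k).
  have eqX x y : x = y by apply: shift_space_ext => k; exact: deterministic_constant.
  have [B0|/set0P[x Bx]] := eqVneq B set0; first by left; rewrite B0 measure0.
  right; rewrite (_ : ~` B = set0) ?measure0//.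
  by apply/seteqP; split => y //; apply; rewrite (eqX y x).
move=> /existsNP[b /existsNP[j /existsNP[k /not_implyP[bj /not_implyP[bk jk]]]]].
have [s [s' [ps ps' ls ss' ss]]] := exchangeable_words bj bk jk.
have adm (l : seq 'I_n.+1) : path step b l ->
    forall t, (t < size l)%N -> A (nth b (b :: l) t) (nth b (b :: l) t.+1) = 1%N.
  by move=> /(pathP b) pl t tl; apply/eqP; exact: pl.
have N1 := follows_infinitely_often (adm s ps).
have N2 := follows_infinitely_often (adm s' ps').
(* A candidate for the maximum shares the tail of [x], hence contains [s], and replacing it by the
   larger word [s'] gives a larger point of the class. The minimum is excluded with the words
   exchanged. *)
have nmax x : infinitely_often (fun m => follows m (size s) (nth b (b :: s))) x ->
    ~ class_has_max x.
  move=> Ix [y [[K [tl pm]] ymax]]; have [m Km fx] := Ix K.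
  have fy : follows m (size s) (nth b (b :: s)) y.
    by move=> t ts; rewrite -tl ?fx//; lia.
  have [z [yz /(_ ss) z1 _]] := swap_words ps ps' ls ss' fy.
  by apply: ymax z1; apply: S_rel_trans yz; exists K.
have nmin x : infinitely_often (fun m => follows m (size s') (nth b (b :: s'))) x ->
    ~ class_has_min x.
  move=> Ix [y [[K [tl pm]] ymin]]; have [m Km fx] := Ix K.
  have fy : follows m (size s') (nth b (b :: s')) y.
    by move=> t ts; rewrite -tl ?fx//; lia.
  have ss'' : perm_eq s' s by rewrite perm_sym.
  have [z [yz _ /(_ ss) z1]] := swap_words ps' ps (esym ls) ss'' fy.
  by apply: ymin z1; apply: S_rel_trans yz; exists K.
have [S0|S1] := Serg mB; [left|right]; apply: measure_negligible => //.
- by apply: negligibleS S0 => x Bx; exists x => //; exact: S_rel_refl.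
- exact: measurableC.
(* Off the two null sets of non-recurrence, classes are orbits of [adic], so there [B] coincides
   with its saturation. *)
apply: (negligibleS _ (negligibleU S1 (negligibleU N1 N2))) => x nBx.
have [Sx|] := pselect (S_saturation B x); last by left.
right; have [I1|] :=
  pselect (infinitely_often (fun m => follows m (size s) (nth b (b :: s))) x); last by left.
right => I2; apply: nBx; have [y By xy] := Sx.
by apply/(adic_invariant_class adicB (nmax x I1) (nmin x I2) xy).
Qed.

End ErgodicAdic.

(** * The limits of conditional probabilities expressed by deviation events *)

Lemma cond_prob_deviates B E e : 0 < pr E ->
  (e < `|cond_prob mu B E - pr B|) = (e * pr E < `|pr (B `&` E) - pr B * pr E|).
Proof.
move=> E0; rewrite /cond_prob -/(pr _) -/(pr E).
have -> : pr (B `&` E) / pr E - pr B = (pr (B `&` E) - pr B * pr E) / pr E.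
  by rewrite mulrBl mulfK ?gt_eqF.
by rewrite normrM normfV (gtr0_norm E0) ltr_pdivlMr.
Qed.

Lemma count_set_gt0 m x : 0 < pr (count_set (psi0 m.+1 x) m).
Proof.
apply: lt_le_trans (past_class_gt0 m x) _; apply: pr_le.
- exact: past_class_measurable.
- exact: det_measurable (@count_set_det _ m).
- by rewrite -past_classE => y [].
Qed.

Lemma past_limit B : 
  (forall e, 0 < e -> pr (infinitely_often (deviates B e)) = 0) <->
  {ae mu, forall x, (fun m => cond_prob mu B
     (count_set (psi0 m.+1 x) m `&` symbol_set (x m) m)) @ \oo --> pr B}.
Proof.
have devE e : (fun m => [set x : X | e < `|cond_prob mu B
    (count_set (psi0 m.+1 x) m `&` symbol_set (x m) m) - pr B|]) = deviates B e.
  apply/funext => m; apply/funext => x.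
  by rewrite /deviates /= past_classE cond_prob_deviates ?past_class_gt0.
rewrite -infinitely_often_ae_cvg => [|e m].
  by split=> H e e0; [rewrite devE|rewrite -devE]; exact: H.
by rewrite -[X in measurable X]/((fun m => [set x : X | _]) m) devE; exact: deviates_measurable.
Qed.

Lemma count_limit B :
  (forall e, 0 < e -> pr (infinitely_often (count_deviates B e)) = 0) <->
  {ae mu, forall x, (fun m => cond_prob mu B (count_set (psi0 m.+1 x) m)) @ \oo --> pr B}.
Proof.
have devE e : (fun m => [set x : X | e < `|cond_prob mu B
    (count_set (psi0 m.+1 x) m) - pr B|]) = count_deviates B e.
  apply/funext => m; apply/funext => x.
  by rewrite /count_deviates /= cond_prob_deviates// count_set_gt0.
rewrite -infinitely_often_ae_cvg => [|e m].
  by split=> H e e0; [rewrite devE|rewrite -devE]; exact: H.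
rewrite -[X in measurable X]/((fun m => [set x : X | _]) m) devE.
exact: det_measurable (@count_deviates_det B e m).
Qed.

Lemma ergodic_S_limits B : ergodic_S mu -> measurable B ->
  {ae mu, forall x,
    (fun m => cond_prob mu B
       (count_set (psi0 m.+1 x) m `&` symbol_set (x m) m)) @ \oo --> pr B /\
    (fun m => cond_prob mu B (count_set (psi0 m.+1 x) m)) @ \oo --> pr B}.
Proof.
move=> Serg mB.
have H1 := (past_limit B).1 (fun e => @deviates_null Serg B e mB).
have H2 := (count_limit B).1 (fun e => @count_deviates_null Serg B e mB).
by apply: filterS2 H1 H2 => x.
Qed.

End MarkovMeasure.

Theorem proposition7p1 (R : realType) (n : nat) (A : 'M[nat]_n.+1)
    (A01 : zero_one_mx A) (Airr : irreducible_mx A) (Aaper : aperiodic_mx A)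
    (P : 'M[R]_n.+1) (Pstoch : stochastic_mx P) (PA : compatible_mx P A)
    (p : 'rV[R]_n.+1) (pprob : probability_vector p) (pP : p *m P = p)
    (mu : probability (shift_space A01 Airr) R)
    (muP : is_markov_measure P p mu) :
  [<-> ergodic_map mu (@adic n A A01 Airr);
       ergodic_S mu;
       forall B : set (shift_space A01 Airr), measurable B ->
         {ae mu, forall x : shift_space A01 Airr,
           (fun m : nat => cond_prob mu B
              (count_set (psi0 m.+1 x) m `&` symbol_set (x m) m)) @ \oo
             --> fine (mu B) /\
           (fun m : nat => cond_prob mu B (count_set (psi0 m.+1 x) m)) @ \oo
             --> fine (mu B)};
       forall i : 'I_n.+1,
         {ae mu, forall x : shift_space A01 Airr,
           (fun m : nat => cond_prob mu (symbol_set i 0)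
              (count_set (psi0 m.+1 x) m `&` symbol_set (x m) m)) @ \oo
             --> p 0 i /\
           (fun m : nat => cond_prob mu (symbol_set i 0)
              (count_set (psi0 m.+1 x) m)) @ \oo --> p 0 i}].
Proof.
tfae.
- exact: ergodic_map_ergodic_S muP.
- by move=> Serg B mB; exact: (ergodic_S_limits Pstoch PA pprob pP muP).
- move=> H i; rewrite -(pr_symbol muP i); apply: H.
  exact: symbol_set_measurable.
move=> H; apply: (ergodic_S_ergodic_map Pstoch PA pprob pP muP).
apply: (symbol_limit_ergodic Pstoch PA pprob pP muP) => i.
apply/(past_limit Pstoch PA pprob pP muP).
by have := H i; rewrite -(pr_symbol muP i); apply: filterS => x [].
Qed.
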